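(* For any $n \geq 6$, there is a family $\mathcal A$ of $n$ open sets in $\mathbb R^2$ such that the intersection of every subfamily is either empty or path-connected, and for which $f_3(\mathcal A) = 0$ and $f_2(\mathcal A) \geq \binom{n-1}{2}+\frac13(n^2-6n+3)$. For infinitely many $n$ there exists a family $\mathcal B$ of $n$ open sets in $\mathbb R^2$ such that the intersection of every subfamily is either empty or path-connected, and for which $f_3(\mathcal B)=0$ and $f_2(\mathcal B) = \binom{n-1}{2}+\frac13(n^2-4n+3)$. Furthermore, in both cases all but one of the sets of $\mathcal A$ (respectively $\mathcal B$) are contractible, and the intersections of all pairs and all triples of sets are contractible.
   Context: For a finite family $\mathcal A=\{A_1,\dots,A_n\}$ of sets and $\sigma\subseteq[n]$, write $A_\sigma=\bigcap_{i\in\sigma}A_i$. For $k\ge 0$, $f_k(\mathcal A)$ is the number of $\sigma\subseteq[n]$ with $|\sigma|=k+1$ and $A_\sigma\neq\emptyset$. *)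

(* Defs.v *)
From mathcomp Require Import all_boot all_order all_algebra.
From mathcomp Require Import all_classical all_reals all_analysis.
Import Order.TTheory GRing.Theory Num.Theory.
Import numFieldNormedType.Exports.

Set Implicit Arguments.
Unset Strict Implicit.
Unset Printing Implicit Defensive.

Local Open Scope classical_set_scope.
Local Open Scope ring_scope.

(* Vacuously true of the empty set. *)
Definition path_connected (R : realType) (T : topologicalType) (S : set T) :
    Prop :=
  forall x y : T, S x -> S y ->
    exists g : R -> T,
      [/\ {within `[0, 1]%classic, continuous g}, g 0 = x, g 1 = y
        & forall t : R, 0 <= t <= 1 -> S (g t)].

(* The identity of S is homotopic, within S, to a constant map. As the point
   c must belong to S, a contractible set is nonempty. *)
Definition contractible (R : realType) (T : topologicalType) (S : set T) :
    Prop :=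
  exists c : T, S c /\
    exists H : R * T -> T,
      [/\ {within `[0, 1]%classic `*` S, continuous H},
          forall (t : R) (x : T), 0 <= t <= 1 -> S x -> S (H (t, x)),
          forall x : T, S x -> H (0, x) = x
        & forall x : T, S x -> H (1, x) = c].

(* A_sigma; it is the whole space when sigma is empty. *)
Definition meet (T : Type) (n : nat) (A : 'I_n -> set T) (s : {set 'I_n}) :
    set T :=
  \bigcap_(i in [set` s]) A i.

Definition fnum (T : Type) (n : nat) (A : 'I_n -> set T) (k : nat) : nat :=
  #|[set s : {set 'I_n} | (#|s| == k.+1) && `[< meet A s !=set0 >]]%SET|.

(* "All but one" is read as: there is exactly one exception. The pairwise
   intersections are contractible, hence nonempty; triples of sets may have an
   empty intersection. *)
Definition contractible_but_one (R : realType) (T : topologicalType) (n : nat)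
    (A : 'I_n -> set T) : Prop :=
  [/\ exists i0 : 'I_n, forall i : 'I_n, contractible R (A i) <-> i <> i0,
      forall s : {set 'I_n}, #|s| = 2%N -> contractible R (meet A s)
    & forall s : {set 'I_n}, #|s| = 3%N ->
        meet A s = set0 \/ contractible R (meet A s)].

(* Main.v *)
Require Import Defs.
From mathcomp Require Import all_boot all_order all_algebra.
From mathcomp Require Import all_classical all_reals all_analysis.
From mathcomp Require Import ring lra zify.
Import Order.TTheory GRing.Theory Num.Theory.
Import numFieldNormedType.Exports.

(* Three walls bound a triangle, and m = 3 q + 1 thick lines, each made of two
   arms reflected in a wall, cross pairwise in exactly one integer point of the
   triangle; three of them have a common point exactly when their indices add up
   to one of two residues modulo m.  Since 3 is invertible modulo m, this happens
   for (m - 1) (m - 2) / 3 triples.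
   Thinning all the lines destroys the triple points but keeps all the crossings.
   Hence the net, the union of the thin lines and of a rim outside the walls,
   meets every pair of lines but no triple, so that it contributes all the
   triples containing it.  The net has holes: a map separating three parts of the
   contour of one hole has nonzero winding number, which obstructs a contraction.
   The comb, made of the rim and of teeth reaching into the faces between
   adjacent lines along the walls, adds m - 1 triples.  All the other
   intersections are star-shaped sets, or are obtained from one by gluing
   star-shaped pieces along star-shaped overlaps.
   The full family has 3 q + 3 members; the remaining sizes come from deleting
   the comb, and then a line. *)

Set Implicit Arguments.
Unset Strict Implicit.
Unset Printing Implicit Defensive.

Local Open Scope classical_set_scope.
Local Open Scope ring_scope.

(** * Gluing contractible sets *)

Section Within.
Context {T U W : topologicalType}.

(** The constants come from a third coordinate chosen so that the three add up to [3/2], not to an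
    integer. Lines of radius [1/5] at integer positions [i], [j], [k] can share a point only if
    [|i + j + k - 3/2| < 3/5], hence only for the sums 1 and 2; this is why two residues occur. If
    one of the three lines has radius [1/10], the bound becomes a strict [1/2] and no integer sum is
    left. The obstacle is to keep every intersection other than the net itself simple. A closed rim
    would be a ring, so it is left open at one corner of the triangle. The teeth must meet the thick
    lines of their face but stay clear of the thin ones inside the walls, so their margin [3/20]
    lies between [1/10] and [1/5]. An arm stops [2/5] before the wall that it does not start from:
    crossings sit at half-integral distance from such a wall, so none is lost, while the rim beyond
    that wall is never touched. *)

Lemma withinP (X Y : topologicalType) (B : set X) (f : X -> Y) :
  {within B, continuous f} <->
  forall x, B x -> forall N, nbhs (f x) N -> nbhs x [set y | B y -> N (f y)].
Proof.
split=> [/subspace_continuousP h x Bx N Nx|h]; first exact: h Bx N Nx.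
by apply/subspace_continuousP => x Bx N Nx; exact: h Bx N Nx.
Qed.

Lemma within_at (B : set T) (f : T -> U) :
  (forall x, B x -> {for x, continuous f}) -> {within B, continuous f}.
Proof.
move=> cf; apply/withinP => x Bx N Nx.
have : nbhs x (f @^-1` N) by exact: cf.
by apply: filterS => y Ny _.
Qed.

Lemma pair_continuous (f : T -> U) (g : T -> W) x :
  {for x, continuous f} -> {for x, continuous g} ->
  {for x, continuous (fun z => (f z, g z))}.
Proof. by move=> cf cg; apply: cvg_pair. Qed.

Lemma within_comp (B : set T) (D : set U) (f : T -> U) (h : U -> W) :
  {within B, continuous f} -> (forall x, B x -> D (f x)) ->
  {within D, continuous h} -> {within B, continuous (h \o f)}.
Proof.
move=> /withinP cf fBD /withinP ch; apply/withinP => x Bx N Nx.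
have := cf x Bx _ (ch _ (fBD _ Bx) _ Nx).
by apply: filterS => y /= hy By; exact: hy (By) (fBD _ By).
Qed.

Lemma within_closed_cover (D C1 C2 : set T) (f : T -> U) :
  closed C1 -> closed C2 -> C1 `|` C2 = setT ->
  {within D `&` C1, continuous f} -> {within D `&` C2, continuous f} ->
  {within D, continuous f}.
Proof.
move=> c1 c2 C12 f1 f2; apply/withinP => x Dx N Nx.
have near_part (C : set T) : closed C -> {within D `&` C, continuous f} ->
    nbhs x [set y | D y -> C y -> N (f y)].
  move=> cC /withinP fC; have [Cx|nCx] := pselect (C x).
    have := fC x (conj Dx Cx) _ Nx.
    by apply: filterS => y hy Dy Cy; exact: hy.
  have : nbhs x (~` C).
    by apply: open_nbhs_nbhs; split => //; exact: closed_openC.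
  by apply: filterS => y nCy _ /nCy.
have := near_part _ c1 f1; have := near_part _ c2 f2.
apply: filterS2 => y h2 h1 Dy.
have : (C1 `|` C2) y by rewrite C12.
by case=> [/h1|/h2]; apply.
Qed.

End Within.

Section Gap.
Context {R : realType} {V : normedModType R}.

(* A capped distance to the complement of A; the cap keeps it finite when A
   is the whole space. *)
Definition gap (A : set V) (x : V) : R :=
  inf ([set Num.min 1 `|x - y| | y in ~` A] `|` [set 1]).

Let vals (A : set V) (x : V) : set R := [set Num.min 1 `|x - y| | y in ~` A] `|` [set 1].

Let vals_inf A x : has_inf (vals A x).
Proof.
split; first by exists 1; right.
exists 0 => r [[y _ <-]|->]; last exact: ler01.
by rewrite le_min ler01 normr_ge0.
Qed.

Lemma gap_ge0 A x : 0 <= gap A x.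
Proof.
apply: lb_le_inf; first by case: (vals_inf A x).
move=> r [[y _ <-]|->]; last by [].
by rewrite le_min ler01 normr_ge0.
Qed.

Lemma gap_notin A x : ~ A x -> gap A x = 0.
Proof.
move=> nAx; apply/eqP; rewrite eq_le gap_ge0 andbT.
apply: (ge_inf (vals_inf A x).2).
by left; exists x => //; rewrite subrr normr0 min_r.
Qed.

Lemma gap_gt0 A x : open A -> A x -> 0 < gap A x.
Proof.
move=> oA Ax.
have : nbhs x A by apply: open_nbhs_nbhs.
rewrite -nbhs_ballE => -[e /= e0 eA].
apply: (@lt_le_trans _ _ (Num.min 1 e)); first by rewrite lt_min ltr01.
apply: lb_le_inf; first by case: (vals_inf A x).
move=> r [[y nAy <-]|->]; last by rewrite ge_min lexx.
rewrite le_min ge_min lexx /= ge_min; apply/orP; right.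
rewrite leNgt; apply/negP => xy; apply: nAy; apply: eA.
by rewrite -ball_normE.
Qed.

Lemma gap_lip A x y : gap A x <= gap A y + `|x - y|.
Proof.
rewrite -lerBlDr; apply: lb_le_inf; first by case: (vals_inf A y).
move=> r [[z nAz <-]|->]; rewrite lerBlDr.
  apply: (@le_trans _ _ (Num.min 1 `|x - z|)).
    by apply: (ge_inf (vals_inf A x).2); left; exists z.
  have := ler_normD (x - y) (y - z); rewrite addrA subrK => h.
  rewrite /Num.min; case: ifPn => h1; case: ifPn => h2; have := normr_ge0 (x-y); lra.
apply: (@le_trans _ _ 1); first by apply: (ge_inf (vals_inf A x).2); right.
by rewrite lerDl.
Qed.

Lemma gap_continuous A : continuous (gap A).
Proof.
move=> x; apply/cvgrPdist_lt => e e0.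
near=> y.
have xy : `|x - y| < e by near: y; apply: cvgr_dist_lt.
rewrite ltr_norml; have := gap_lip A x y; have := gap_lip A y x.
by rewrite distrC; lra.
Unshelve. all: end_near. Qed.

End Gap.

Section Star.
Context {R : realType} {V : normedModType R}.
Implicit Types (S U P : set V) (c p : V).

Definition star S c := S c /\
  forall p (t : R), 0 <= t <= 1 -> S p -> S (p + t *: (c - p)).

Lemma slide_continuous c (l : V -> R) (t : R) (x : V) :
  {for x, continuous l} ->
  {for (t, x), continuous (fun z : R * V => z.2 + (z.1 * l z.2) *: (c - z.2))}.
Proof.
move=> cl.
have c2 : {for (t, x), continuous (fun z : R * V => z.2)} by exact: cvg_snd.
apply: cvgD => //; apply: cvgZ; last by apply: cvgB => //; exact: cvg_cst.
apply: cvgM; first exact: cvg_fst.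
exact: (cvg_comp _ l c2 cl).
Qed.

Lemma star_contractible S c : star S c -> contractible R S.
Proof.
move=> [Sc St]; exists c; split => //.
exists (fun z : R * V => z.2 + (z.1 * 1) *: (c - z.2)); split.
- apply: continuous_subspaceT => -[t x].
  by apply: (@slide_continuous c (fun=> 1)); exact: cst_continuous.
- by move=> t x t01 Sx /=; rewrite mulr1; exact: St.
- by move=> x _ /=; rewrite mul0r scale0r addr0.
- by move=> x _ /=; rewrite mulr1 scale1r addrC subrK.
Qed.

Lemma starU S S' c : star S c -> star S' c -> star (S `|` S') c.
Proof.
move=> [Sc St] [Sc' St']; split; first by left.
by move=> p t t01 [/St|/St']; [left|right]; auto.
Qed.

Lemma starI S S' c : star S c -> star S' c -> star (S `&` S') c.
Proof.
move=> [Sc St] [Sc' St']; split; first by split.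
by move=> p t t01 [Sp Sp']; split; auto.
Qed.

(* Points of P are pulled towards c, at full strength outside U and not at all
   outside P; this moves U `|` P into U without leaving U `|` P. *)
Lemma contractible_glue U P c : open U -> open P -> contractible R U ->
  star P c -> star (U `&` P) c -> contractible R (U `|` P).
Proof.
move=> oU oP [b [Ub [G [cG GS G0 G1]]]] [Pc Pst] [[Uc _] UPst].
pose l x := gap P x / (gap P x + gap U x).
have den x : (U `|` P) x -> 0 < gap P x + gap U x.
  have := gap_ge0 P x; have := gap_ge0 U x.
  move=> h1 h2 [/(gap_gt0 oU)|/(gap_gt0 oP)]; lra.
have l01 x : (U `|` P) x -> 0 <= l x <= 1.
  move=> UPx; have d0 := den _ UPx; have := gap_ge0 P x; have := gap_ge0 U x.
  move=> h1 h2; apply/andP; split; first by apply: divr_ge0 => //; lra.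
  by rewrite ler_pdivrMr //; lra.
have lP x : ~ P x -> l x = 0 by move=> /gap_notin; rewrite /l => ->; rewrite mul0r.
have lU x : P x -> ~ U x -> l x = 1.
  move=> Px /gap_notin; rewrite /l => ->; rewrite addr0 divff //.
  by apply: lt0r_neq0; exact: gap_gt0.
have lcont x : (U `|` P) x -> {for x, continuous l}.
  move=> UPx; apply: cvgM; first exact: gap_continuous.
  apply: cvgV; first by apply: lt0r_neq0; exact: den.
  by apply: cvgD; exact: gap_continuous.
pose K (z : R * V) := z.2 + (z.1 * l z.2) *: (c - z.2).
have Kcont t x : (U `|` P) x -> {for (t, x), continuous K}.
  by move=> UPx; apply: slide_continuous; exact: lcont.
have K0 x : K (0, x) = x by rewrite /K /= mul0r scale0r addr0.
have KS t x : 0 <= t <= 1 -> (U `|` P) x -> (U `|` P) (K (t, x)).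
  move=> t01 UPx; have /andP[l0 l1] := l01 _ UPx.
  have tl : 0 <= t * l x <= 1.
    case/andP: t01 => t0 t1; rewrite mulr_ge0 //=.
    by rewrite -[1]mulr1 ler_pM.
  have [Px|nPx] := pselect (P x); first by right; exact: Pst.
  by rewrite /K /= lP // mulr0 scale0r addr0.
have K1 x : (U `|` P) x -> U (K (1, x)).
  move=> UPx; have l1 := l01 _ UPx; rewrite /K /= mul1r.
  have [Px|nPx] := pselect (P x); last first.
    by rewrite lP // scale0r addr0; case: UPx.
  have [Ux|nUx] := pselect (U x); first by have [] := UPst x (l x) l1 (conj Ux Px).
  by rewrite lU // scale1r addrC subrK.
exists b; split; first by left.
pose H (z : R * V) := if z.1 <= 1/2 then K (2 * z.1, z.2)
                      else G (2 * z.1 - 1, K (1, z.2)).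
have in01 (t : R) : `[0, 1]%classic t -> 0 <= t <= 1 by rewrite /= in_itv.
have HK t x : t <= 1/2 -> H (t, x) = K (2 * t, x) by move=> h; rewrite /H /= h.
have HG t x : 1/2 <= t -> (U `|` P) x -> H (t, x) = G (2 * t - 1, K (1, x)).
  move=> ht UPx; rewrite /H /=; case: ifPn => // ht'.
  have -> : t = 1/2 by apply/eqP; rewrite eq_le ht ht'.
  have -> : 2 * (1/2) = 1 :> R by lra.
  by rewrite subrr G0 //; exact: K1.
exists H; split.
- pose C1 := [set z : R * V | z.1 <= 1/2]; pose C2 := [set z : R * V | 1/2 <= z.1].
  have cl1 : closed C1.
    apply: (@closed_comp _ _ (fun z : R * V => z.1) [set t | t <= 1/2]).
      by move=> z _; exact: cvg_fst.
    exact: closed_le.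
  have cl2 : closed C2.
    apply: (@closed_comp _ _ (fun z : R * V => z.1) [set t | 1/2 <= t]).
      by move=> z _; exact: cvg_fst.
    exact: closed_ge.
  apply: (within_closed_cover cl1 cl2).
    by apply/seteqP; split => // z _; case: (lerP z.1 (1/2)) => h; [left|right; exact: ltW].
  + apply: (@subspace_eq_continuous _ _ _ (fun z : R * V => K (2 * z.1, z.2))).
      by move=> -[t x] /set_mem [_ h]; apply/esym; exact: HK.
    apply: within_at => -[t x] [[/= t01 UPx] _].
    apply: (@continuous_comp _ _ _ (fun z : R * V => (2 * z.1, z.2)) K); last exact: Kcont.
    apply: pair_continuous; last exact: cvg_snd.
    by apply: cvgM; [exact: cvg_cst|exact: cvg_fst].
  + apply: (@subspace_eq_continuous _ _ _ (fun z : R * V => G (2 * z.1 - 1, K (1, z.2)))).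
      by move=> -[t x] /set_mem [[/= _ UPx] h]; apply/esym; exact: HG.
    apply: (@within_comp _ _ _ _ _ (fun z : R * V => (2 * z.1 - 1, K (1, z.2))) G _ _ cG).
      apply: within_at => -[t x] [[/= t01 UPx] _].
      apply: pair_continuous.
        apply: cvgB; last exact: cvg_cst.
        by apply: cvgM; [exact: cvg_cst|exact: cvg_fst].
      apply: (@continuous_comp _ _ _ (fun z : R * V => (1, z.2) : R * V) K); last exact: Kcont.
      by apply: pair_continuous; [exact: cvg_cst|exact: cvg_snd].
    move=> -[t x] [[/= /in01 t01 UPx] h]; split => /=; last exact: K1.
    by rewrite in_itv /=; case/andP: t01 => _ t1; move: h; rewrite /C2 /= => h;
      apply/andP; split; lra.
- move=> t x t01 UPx; case: (lerP t (1/2)) => ht.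
    rewrite HK //; apply: KS => //; case/andP: t01 => t0 _; apply/andP; split; lra.
  rewrite HG ?ltW //; left; apply: GS; last exact: K1.
  case/andP: t01 => _ t1; apply/andP; split; lra.
- by move=> x UPx; rewrite HK ?mulr0 ?K0//; lra.
- move=> x UPx; rewrite HG //; last by lra.
  by rewrite mulr1 (_ : 2 - 1 = 1 :> R) ?G1//; [exact: K1|lra].
Qed.

End Star.

Section Attach.
Context {R : realType} {V : normedModType R}.

(** As two pieces overlap only inside [W], a new piece meets everything glued so far exactly in its
    overlap with [W], which is star-shaped; so the pieces can be glued one at a time. *)
Lemma contractible_attach (I : eqType) (s : seq I) (W : set V) (P : I -> set V)
    (c : I -> V) :
  open W -> contractible R W ->
  (forall i, i \in s -> [/\ open (P i), star (P i) (c i) & star (W `&` P i) (c i)]) ->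
  (forall i j, i \in s -> j \in s -> i != j -> P i `&` P j `<=` W) ->
  contractible R (W `|` [set p | exists2 i, i \in s & P i p]).
Proof.
move=> oW cW; elim: s => [_ _|i s IH hs hd].
  by rewrite (_ : [set _ | _] = set0) ?setU0 //; apply/seteqP; split=> // p [].
have hs' j : j \in s -> j \in i :: s by rewrite inE => ->; rewrite orbT.
have {}IH : contractible R (W `|` [set p | exists2 i, i \in s & P i p]).
  by apply: IH => [j /hs'/hs //|j k /hs' js /hs' ks]; exact: hd.
set U := W `|` _ in IH.
have [si|si] := boolP (i \in s).
  rewrite (_ : _ `|` _ = U) //; apply/seteqP; split=> p [Wp|[j js Pj]].
  - by left.
  - by right; exists j => //; move: js; rewrite inE => /predU1P[->|].
  - by left.
  - by right; exists j => //; exact: hs'.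
have [oP sP sWP] := hs i (mem_head _ _).
rewrite (_ : _ `|` _ = U `|` P i); last first.
  apply/seteqP; split=> p.
    move=> [Wp|[j]]; first by left; left.
    by rewrite inE => /predU1P[->|js] Pj; [right|left; right; exists j].
  move=> [[Wp|[j js Pj]]|Pi]; first by left.
    by right; exists j => //; exact: hs'.
  by right; exists i => //; exact: mem_head.
apply: (@contractible_glue _ _ _ _ (c i)) => //.
  apply: openU => //; rewrite (_ : [set _ | _] = \bigcup_(j in [set` s]) P j) //.
  by apply: bigcup_open => j /hs'/hs[].
rewrite (_ : U `&` P i = W `&` P i) //; apply/seteqP; split=> p [].
  move=> [Wp Pp|[j js Pj Pi]]; first by split.
  split=> //; apply: (hd j i); rewrite ?mem_head ?hs' //.
  by apply: contraNneq si => <-.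
by move=> Wp Pp; split=> //; left.
Qed.

End Attach.

(** * Paths and path-connectedness *)

Section Joined.
Context {R : realType} {T : topologicalType}.
Implicit Types (S : set T) (x y z : T).

Definition joined S x y := exists g : R -> T,
  [/\ {within `[0, 1]%classic, continuous g}, g 0 = x, g 1 = y
    & forall t : R, 0 <= t <= 1 -> S (g t)].

Lemma joined_sub S S' x y : S `<=` S' -> joined S x y -> joined S' x y.
Proof. by move=> SS' [g [cg g0 g1 gS]]; exists g; split=> // t /gS/SS'. Qed.

Lemma affine_within (u v : R) (B D : set R) (g : R -> T) :
  {within D, continuous g} -> (forall t, B t -> D (u * t + v)) ->
  {within B, continuous (fun t => g (u * t + v))}.
Proof.
move=> cg BD; apply: (@within_comp _ _ _ B D (fun t => u * t + v) g) => //.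
apply: continuous_subspaceT => t; apply: cvgD; last exact: cvg_cst.
by apply: cvgM; [exact: cvg_cst|exact: cvg_id].
Qed.

Lemma joined_sym S x y : joined S x y -> joined S y x.
Proof.
move=> [g [cg g0 g1 gS]]; exists (fun t => g ((-1) * t + 1)); split.
- apply: (affine_within cg) => t /=; rewrite !in_itv /=; lra.
- by rewrite mulr0 add0r.
- by rewrite mulr1 addNr.
- by move=> t t01; apply: gS; lra.
Qed.

Lemma joined_trans S x y z : joined S x y -> joined S y z -> joined S x z.
Proof.
move=> [g [cg g0 g1 gS]] [h [ch h0 h1 hS]].
pose k t := if t <= 1/2 then g (2 * t + 0) else h (2 * t + (-1)).
have kg t : t <= 1/2 -> k t = g (2 * t + 0) by rewrite /k => ->.
have kh t : 1/2 <= t -> k t = h (2 * t + (-1)).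
  move=> t2; rewrite /k; case: ifPn => // t2'; have -> : t = 1/2 by lra.
  rewrite (_ : 2 * (1/2) + 0 = 1); last by lra.
  rewrite (_ : 2 * (1/2) + -1 = 0); last by lra.
  by rewrite g1 h0.
exists k; split.
- apply: (@within_closed_cover _ _ _ [set t : R | t <= 1/2] [set t : R | 1/2 <= t]).
  + exact: closed_le.
  + exact: closed_ge.
  + by apply/seteqP; split=> // t _; case: (lerP t (1/2)) => ?; [left|right; exact: ltW].
  + apply: (@subspace_eq_continuous _ _ _ (fun t : R => g (2 * t + 0))).
      by move=> t /set_mem [_ t2]; apply/esym; exact: kg.
    by apply: (affine_within cg) => t [] /=; rewrite !in_itv /=; lra.
  + apply: (@subspace_eq_continuous _ _ _ (fun t : R => h (2 * t + (-1)))).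
      by move=> t /set_mem [_ t2]; apply/esym; exact: kh.
    by apply: (affine_within ch) => t [] /=; rewrite !in_itv /=; lra.
- rewrite kg; last by lra.
  by rewrite mulr0 addr0.
- rewrite kh; last by lra.
  by rewrite (_ : 2 * 1 + -1 = 1); last by lra.
- move=> t t01; case: (lerP t (1/2)) => ht.
    by rewrite kg //; apply: gS; lra.
  by rewrite kh ?ltW //; apply: hS; lra.
Qed.

Lemma contractible_path_connected S : contractible R S -> path_connected R S.
Proof.
move=> [c [Sc [H [cH HS H0 H1]]]].
have to_c x : S x -> joined S x c.
  move=> Sx; exists (fun t => H (t, x)); split.
  - apply: (@within_comp _ _ _ _ _ (fun t => (t, x)) H _ _ cH).
      apply: continuous_subspaceT => t.
      by apply: pair_continuous; [exact: cvg_id|exact: cvg_cst].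
    by move=> t.
  - exact: H0.
  - exact: H1.
  - by move=> t t01; exact: HS.
by move=> x y /to_c xc /to_c yc; apply: joined_trans xc (joined_sym yc).
Qed.

Lemma path_connected_bigcup (I : Type) (P : I -> set T) x0 :
  (forall i x, P i x -> joined (\bigcup_i P i) x x0) ->
  path_connected R (\bigcup_i P i).
Proof.
move=> h x y [i _ Px] [j _ Py].
exact: joined_trans (h _ _ Px) (joined_sym (h _ _ Py)).
Qed.

End Joined.

(** * A winding number obstruction *)

Section Winding.

Definition turn (u v : nat) : int :=
  if u == v then 0 else if v == (u.+1 %% 3)%N then 1 else -1.

(** With at most two of the three cyclic colours present, the colours lift to integers and [turn] is
    the difference of the lifts, so both ways across the square give the same total. *)
Lemma turn_square u v w x : (u < 3)%N -> (v < 3)%N -> (w < 3)%N -> (x < 3)%N ->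
  ~~ [&& 0%N \in [:: u; v; w; x], 1%N \in [:: u; v; w; x] & 2%N \in [:: u; v; w; x]] ->
  turn u v + turn v x - turn w x - turn u w = 0.
Proof.
by case: u => [|[|[|]]] //; case: v => [|[|[|]]] //;
   case: w => [|[|[|]]] //; case: x => [|[|[|]]].
Qed.

(** Discrete homotopy invariance: consecutive rows differ by the turns along the vertical edges,
    which telescope and cancel because the first and the last column agree. *)
Lemma winding_const (c : nat -> nat -> nat) (M N : nat) :
  (forall i j, (c i j < 3)%N) ->
  (forall i j, (i < N)%N -> (j < M)%N ->
     let s := [:: c i j; c i j.+1; c i.+1 j; c i.+1 j.+1] in
     ~~ [&& 0%N \in s, 1%N \in s & 2%N \in s]) ->
  (forall i, c i 0%N = c i M) ->
  \sum_(j < M) turn (c 0%N j) (c 0%N j.+1) = \sum_(j < M) turn (c N j) (c N j.+1).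
Proof.
move=> c3 sq per.
suff h i : (i <= N)%N -> \sum_(j < M) turn (c 0%N j) (c 0%N j.+1)
    = \sum_(j < M) turn (c i j) (c i j.+1) by exact: h.
elim: i => [//|i IH iN]; rewrite IH ?(ltnW iN)//.
apply/eqP; rewrite -subr_eq0 -sumrB.
pose L j := - turn (c i j) (c i.+1 j).
have E : forall j : 'I_M, true ->
    turn (c i j) (c i j.+1) - turn (c i.+1 j) (c i.+1 j.+1) = L j.+1 - L j.
  move=> j _; have := turn_square (c3 _ _) (c3 _ _) (c3 _ _) (c3 _ _)
    (sq _ _ iN (ltn_ord j)); rewrite /L; lia.
rewrite (eq_bigr _ E) -(big_mkord xpredT (fun j => L j.+1 - L j)).
rewrite telescope_sumr // /L.
by rewrite !per subrr.
Qed.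

End Winding.

Section Hole.
Context {R : realType}.

Lemma unif_cont_grid (F : R * R -> R * R) (a b e : R) : 0 < e -> continuous F ->
  exists N : nat, forall x y : R * R,
    0 <= x.1 <= a -> 0 <= x.2 <= b -> `|x - y| <= N.+1%:R^-1 -> `|F x - F y| < e.
Proof.
move=> e0 cF.
have K : compact (`[0, a]%classic `*` `[0, b]%classic : set (R * R)).
  by apply: compact_setX; exact: segment_compact.
move/compact_near_coveringP: K => K.
pose P (n : nat) (x : R * R) := forall y, `|x - y| <= n.+1%:R^-1 -> `|F x - F y| < e.
have [x _|N _ hN] := K nat \oo P _.
  have e2 : 0 < e / 2 by rewrite divr_gt0.
  have := cF x; move/cvgrPdist_lt => /(_ _ e2).
  rewrite near_simpl -nbhs_nearE -nbhs_ballE => -[r /= r0 hr].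
  have r2 : 0 < r / 2 by rewrite divr_gt0.
  have r2r : r / 2 + r / 2 = r by rewrite -splitr.
  have rr : r / 2 <= r by rewrite -{2}r2r lerDl ltW.
  exists (ball x (r / 2), [set n | n.+1%:R^-1 < r / 2]) => /=.
    split; first by apply: nbhsx_ballx.
    exact: near_infty_natSinv_lt (PosNum r2).
  move=> [y n] /= [xy nr] z yz.
  have h1 : `|F x - F y| < e / 2.
    by apply: hr; apply: (@le_ball _ _ x (r / 2)).
  have h2 : `|F x - F z| < e / 2.
    apply: hr; rewrite -ball_normE /= in xy *.
    rewrite (le_lt_trans (ler_distD y _ _)) // -r2r ltrD //.
    exact: le_lt_trans nr.
  by rewrite (le_lt_trans (ler_distD (F x) _ _)) // (distrC (F y)) [e]splitr ltrD.
by exists N => x y x1 x2; apply: (hN N) => //=.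
Qed.

(** Clamping extends the homotopy and the loop to functions continuous on the whole plane, so that
    the grid argument needs no subspace; sums of clamped ramps also make a piecewise linear loop
    continuous at once. *)
Definition clip (x : R) : R := Num.max 0 (Num.min 1 x).

Lemma clip_continuous : continuous clip.
Proof.
move=> x; apply: continuous_max; first exact: cvg_cst.
by apply: continuous_min; [exact: cvg_cst|exact: cvg_id].
Qed.

Lemma clip01 x : 0 <= clip x <= 1.
Proof. by rewrite /clip le_max lexx /= ge_max ler01 ge_min lexx. Qed.

Lemma clip_id x : 0 <= x <= 1 -> clip x = x.
Proof. by move=> /andP[h0 h1]; rewrite /clip min_r // max_r. Qed.

Lemma clip_le0 x : x <= 0 -> clip x = 0.
Proof. by move=> h; rewrite /clip min_r ?max_l//; lra. Qed.

Lemma clip_ge1 x : 1 <= x -> clip x = 1.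
Proof. by move=> h; rewrite /clip min_l // max_r. Qed.

(* The boundary of the triangle with vertices (2, 1), (2, 1/2) and (3/2, 1). *)
Definition tri_loop (s : R) : R * R :=
  (2 - clip (s - 1) / 2 + clip (s - 2) / 2, 1 - clip s / 2 + clip (s - 1) / 2).

Lemma tri_loop1 s : 0 <= s <= 1 -> tri_loop s = (2, 1 - s / 2).
Proof.
move=> h; have e0 : clip s = s by exact: clip_id.
have e1 : clip (s - 1) = 0 by apply: clip_le0; lra.
have e2 : clip (s - 2) = 0 by apply: clip_le0; lra.
by rewrite /tri_loop e0 e1 e2; congr pair; lra.
Qed.

Lemma tri_loop2 s : 1 <= s <= 2 -> tri_loop s = (2 - (s - 1) / 2, s / 2).
Proof.
move=> h; have e0 : clip s = 1 by apply: clip_ge1; lra.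
have e1 : clip (s - 1) = s - 1 by apply: clip_id; lra.
have e2 : clip (s - 2) = 0 by apply: clip_le0; lra.
by rewrite /tri_loop e0 e1 e2; congr pair; lra.
Qed.

Lemma tri_loop3 s : 2 <= s <= 3 -> tri_loop s = (2 - 1/2 + (s - 2) / 2, 1).
Proof.
move=> h; have e0 : clip s = 1 by apply: clip_ge1; lra.
have e1 : clip (s - 1) = 1 by apply: clip_ge1; lra.
have e2 : clip (s - 2) = s - 2 by apply: clip_id; lra.
by rewrite /tri_loop e0 e1 e2; congr pair; lra.
Qed.

Lemma tri_loop_continuous : continuous tri_loop.
Proof.
have cc u : continuous (fun s : R => clip (s - u) / 2).
  move=> s; apply: cvgM; last exact: cvg_cst.
  apply: (@continuous_comp _ _ _ (fun s : R => s - u) clip); last exact: clip_continuous.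
  by apply: cvgB; [exact: cvg_id|exact: cvg_cst].
have cc0 : continuous (fun s : R => clip s / 2).
  by move=> s; apply: cvgM; [exact: clip_continuous|exact: cvg_cst].
move=> s.
have c1 : {for s, continuous (fun s : R => 2 - clip (s - 1) / 2 + clip (s - 2) / 2)}.
  by apply: cvgD; [apply: cvgB; [exact: cvg_cst|exact: cc]|exact: cc].
have c2 : {for s, continuous (fun s : R => 1 - clip s / 2 + clip (s - 1) / 2)}.
  by apply: cvgD; [apply: cvgB; [exact: cvg_cst|exact: cc0]|exact: cc].
exact: (pair_continuous c1 c2).
Qed.

(** Each colour names a side of the hole, the margin [1/10] being the radius of the thin lines.
    Where several sides qualify, the first test wins, so only the exclusion of the earlier sides is
    known for colours 1 and 2. *)
Definition colour (p : R * R) : nat :=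
  if 2 - 1/10 < p.1 then 0%N else if 1 - 1/10 < p.2 then 1%N else 2%N.

Lemma colour_lt p : (colour p < 3)%N.
Proof. by rewrite /colour; case: ifP => // _; case: ifP. Qed.

Lemma colour0 p : colour p = 0%N -> 2 - 1/10 < p.1.
Proof. by rewrite /colour; case: ifP => // _; case: ifP. Qed.

Lemma colour1 p : colour p = 1%N -> p.1 <= 2 - 1/10 /\ 1 - 1/10 < p.2.
Proof. by rewrite /colour; case: ltP => // h; case: ifP. Qed.

Lemma colour2 p : colour p = 2%N -> p.1 <= 2 - 1/10 /\ p.2 <= 1 - 1/10.
Proof. by rewrite /colour; case: ltP => // h; case: ltP. Qed.

(* Off the hole, the three colours correspond to three half-planes without
   common point, so that a small square of the grid never meets all of them. *)
Lemma hole_not_contractible (S : set (R * R)) :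
  (forall s, 0 <= s <= 3 -> S (tri_loop s)) ->
  (forall p, S p -> 2 - 1/10 < p.1 \/ 1 - 1/10 < p.2 \/ p.1 + p.2 < 5/2 + 1/10) ->
  ~ contractible R S.
Proof.
move=> loopS hS [b [Sb [H [cH HS H0 H1]]]].
pose loop s := tri_loop (3 * clip (s / 3)).
have loopE s : 0 <= s <= 3 -> loop s = tri_loop s.
  by move=> h; rewrite /loop clip_id ?[3 * _]mulrC ?divfK//; lra.
have Sloop s : S (loop s) by apply: loopS; have := clip01 (s / 3); lra.
pose F (z : R * R) := H (clip z.1, loop z.2).
have SF z : S (F z) by apply: HS => //; exact: clip01.
have cloop : continuous loop.
  move=> s; apply: (@continuous_comp _ _ _ (fun s : R => 3 * clip (s / 3)) tri_loop).
    apply: cvgM; first exact: cvg_cst.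
    apply: (@continuous_comp _ _ _ (fun s : R => s / 3) clip); last exact: clip_continuous.
    by apply: cvgM; [exact: cvg_id|exact: cvg_cst].
  exact: tri_loop_continuous.
have cF : continuous F.
  apply/continuous_subspace_setT.
  apply: (@within_comp _ _ _ _ _ (fun z : R * R => (clip z.1, loop z.2)) H _ _ cH).
    apply: continuous_subspaceT => z.
    have c1 : {for z, continuous (fun z : R * R => clip z.1)}.
      by apply: (@continuous_comp _ _ _ (fun z : R * R => z.1) clip);
        [exact: cvg_fst|exact: clip_continuous].
    have c2 : {for z, continuous (fun z : R * R => loop z.2)}.
      by apply: (@continuous_comp _ _ _ (fun z : R * R => z.2) loop);
        [exact: cvg_snd|exact: cloop].
    exact: (pair_continuous c1 c2).
  by move=> z _; split => //=; rewrite in_itv /=; exact: clip01.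
have [|N hN] := @unif_cont_grid F 1 3 (1/50) _ cF; first by lra.
pose M := N.+1; pose x (i : nat) : R := i%:R / M%:R.
have M0 : 0 < M%:R :> R by rewrite ltr0n.
have xS i : x i.+1 = x i + M%:R^-1 by rewrite /x -addn1 natrD mulrDl mul1r.
have x_ge0 i : 0 <= x i by rewrite divr_ge0.
have x_le (k i : nat) : (i <= k * M)%N -> x i <= k%:R.
  by move=> ik; rewrite ler_pdivrMr // -natrM ler_nat.
have x_ge (k i : nat) : (k * M <= i)%N -> k%:R <= x i.
  by move=> ik; rewrite ler_pdivlMr // -natrM ler_nat.
have stepM : 0 < M%:R^-1 :> R by rewrite invr_gt0.
have F0 s : F (0, s) = loop s by rewrite /F /= clip_le0 // H0.
have F1 s : F (1, s) = b by rewrite /F /= clip_ge1 // H1.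
have close i j i' j' : (i <= M)%N -> (j <= 3 * M)%N ->
    (i <= i' <= i.+1)%N -> (j <= j' <= j.+1)%N ->
    `|(F (x i, x j)).1 - (F (x i', x j')).1| < 1/50 /\
    `|(F (x i, x j)).2 - (F (x i', x j')).2| < 1/50.
  move=> iM jM ii' jj'.
  have dx (k k' : nat) : (k <= k' <= k.+1)%N -> `|x k - x k'| <= N.+1%:R^-1.
    move=> kk'; have [->|->] : k' = k \/ k' = k.+1 by lia.
      by rewrite subrr normr0 ltW.
    by rewrite xS opprD addNKr normrN gtr0_norm.
  have : `|F (x i, x j) - F (x i', x j')| < 1/50.
    apply: hN => /=.
    - by rewrite x_ge0 /=; apply: (x_le 1%N); rewrite mul1n.
    - by rewrite x_ge0 /=; exact: (x_le 3%N).
    - by rewrite ge_max /= !dx.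
  by rewrite gt_max /= => /andP[].
pose c i j := colour (F (x i, x j)).
have sq i j : (i < M)%N -> (j < 3 * M)%N ->
    let s := [:: c i j; c i j.+1; c i.+1 j; c i.+1 j.+1] in
    ~~ [&& 0%N \in s, 1%N \in s & 2%N \in s].
  move=> iM jM.
  have c00 := close i j i j (ltnW iM) (ltnW jM).
  have c01 := close i j i j.+1 (ltnW iM) (ltnW jM).
  have c10 := close i j i.+1 j (ltnW iM) (ltnW jM).
  have c11 := close i j i.+1 j.+1 (ltnW iM) (ltnW jM).
  rewrite !leqnn !leqnSn in c00 c01 c10 c11.
  have {c00 c01 c10 c11} [c00 c01 c10 c11] := And4 (c00 isT isT) (c01 isT isT)
    (c10 isT isT) (c11 isT isT).
  set p := F (x i, x j) in c00 c01 c10 c11.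
  pose s := [:: F (x i, x j); F (x i, x j.+1); F (x i.+1, x j); F (x i.+1, x j.+1)].
  have sE : [:: c i j; c i j.+1; c i.+1 j; c i.+1 j.+1] = map colour s by [].
  have sp q : q \in s -> `|p.1 - q.1| < 1/50 /\ `|p.2 - q.2| < 1/50.
    by rewrite !inE => /or4P[] /eqP->.
  have sS q : q \in s -> S q by rewrite !inE => /or4P[] /eqP->; exact: SF.
  rewrite /= sE; apply/negP => /and3P[/mapP[p0 /sp[]]].
  rewrite !ltr_norml => a0 b0 /esym/colour0 h0 /mapP[p1 /sp[]].
  rewrite !ltr_norml => a1 b1 /esym/colour1 h1 /mapP[p2 p2s /esym/colour2 h2].
  have [] := sp _ p2s; rewrite !ltr_norml => a2 b2.
  (* The three half-planes miss having a common point by [2 - 1/10 + (1 - 1/10) - (5/2 + 1/10) =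
     1/5], more than the [4/50] by which moving all points to [p] can change the bounds. *)
  have := hS _ (sS _ p2s); lra.
have per i : c i 0%N = c i (3 * M)%N.
  rewrite /c /F /=; congr (colour (H (_, _))).
  have -> : x 0%N = 0 by rewrite /x mul0r.
  have -> : x (3 * M)%N = 3 by rewrite /x natrM mulfK // lt0r_neq0.
  rewrite !loopE; [|lra|lra]; rewrite tri_loop1; last by lra.
  by rewrite tri_loop3; [congr pair; lra|lra].
have := winding_const (fun i j => colour_lt _) sq per.
have xM : x M = 1 by rewrite /x divff // lt0r_neq0.
(* The last row is constant, so its winding is zero; the contradiction is that the first row has
   winding [-3]. *)
rewrite [RHS]big1; last by move=> j _; rewrite /c xM !F1 /turn eqxx.
have x0 : x 0%N = 0 by rewrite /x mul0r.
pose q j := tri_loop (x j).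
have cq j : (j <= 3 * M)%N -> c 0%N j = colour (q j).
  move=> jM; rewrite /c x0 F0 loopE // x_ge0 /=; exact: (x_le 3%N).
have near_q j : (j < 3 * M)%N ->
    `|(q j).1 - (q j.+1).1| < 1/50 /\ `|(q j).2 - (q j.+1).2| < 1/50.
  move=> jM; have := close 0%N j 0%N j.+1 isT (ltnW jM) isT.
  rewrite leqnn leqnSn => /(_ isT).
  by rewrite x0 !F0 !loopE // x_ge0 (x_le 3%N) // ltnW.
(* An integer lift of the colour along the loop. *)
pose L (j : nat) : int := if (j <= 2 * M)%N then
    (if colour (q j) == 0%N then 0 else if colour (q j) == 2%N then -1 else -2)
  else (if colour (q j) == 0%N then -3 else -2).
have leg1 j : (j <= M)%N -> colour (q j) = 0%N.
  move=> jM; rewrite /q tri_loop1; last first.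
    by rewrite x_ge0 /=; apply: (x_le 1%N); rewrite mul1n.
  by rewrite /colour /= ifT //; lra.
have leg2 j : (M <= j)%N -> (j <= 2 * M)%N -> (q j).1 + (q j).2 = 5/2.
  move=> jM jM2; rewrite /q tri_loop2 /=; first by lra.
  by rewrite (x_ge 1%N) ?mul1n // (x_le 2%N).
have leg3 j : (2 * M <= j)%N -> (j <= 3 * M)%N -> colour (q j) != 2%N.
  move=> jM jM2; rewrite /q tri_loop3; last by rewrite (x_ge 2%N) //= (x_le 3%N).
  by rewrite /colour /=; case: ifP => // _; rewrite ifT //; lra.
have turnL j : (j < 3 * M)%N -> turn (c 0%N j) (c 0%N j.+1) = L j.+1 - L j.
  move=> jM; rewrite !cq // ?(ltnW jM)//.
  have [jM1|jM1] := ltnP j M.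
    have a1 := leg1 j (ltnW jM1); have a2 := leg1 j.+1 jM1.
    have -> : L j = 0 by rewrite /L ifT ?a1 //; lia.
    have -> : L j.+1 = 0 by rewrite /L ifT ?a2 //; lia.
    by rewrite a1 a2.
  have [jM2|jM2] := ltnP j (2 * M).
    (* On the slanted side [p.1 + p.2 = 5/2], colour 0 needs [p.1 > 19/10] and colour 1 forces
       [p.1 < 16/10]; a step shorter than [1/50] cannot jump over colour 2. *)
    have [] := near_q j jM; rewrite !ltr_norml.
    have := leg2 j jM1 (ltnW jM2); have := leg2 j.+1 (leqW jM1) jM2.
    rewrite /L jM2 (ltnW jM2) => e1 e2 d1 d2.
    have := colour_lt (q j); have := colour_lt (q j.+1).
    case E1: (colour (q j)) => [|[|[|?]]] //; case E2: (colour (q j.+1)) => [|[|[|?]]] //.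
      by exfalso; have := colour0 E1; have := colour1 E2; lra.
    by exfalso; have := colour1 E1; have := colour0 E2; lra.
  have := leg3 j jM2 (ltnW jM); have := leg3 j.+1 (leqW jM2) jM.
  have := colour_lt (q j); have := colour_lt (q j.+1).
  have -> : L j.+1 = if colour (q j.+1) == 0%N then -3 else -2.
    by rewrite /L leqNgt ltnS jM2.
  (* The formula for [L] changes at [j = 2 * M]; the colour there is 1, for which both branches give
     [-2]. *)
  rewrite /L; have [j2|j2] := leqP j (2 * M).
    have -> : j = (2 * M)%N by apply/eqP; rewrite eqn_leq j2 jM2.
    have -> : colour (q (2 * M)%N) = 1%N.
      rewrite /q (_ : x _ = 2); last by rewrite /x natrM mulfK // lt0r_neq0.
      rewrite tri_loop3 ?lexx /=; last by lra.
      rewrite /colour /=; case: ltP => ?; first by exfalso; lra.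
      by case: ltP => // ?; exfalso; lra.
    by case: (colour (q (2 * M).+1)) => [|[|[|]]].
  by case: (colour (q j)) => [|[|[|]]] //; case: (colour (q j.+1)) => [|[|[|]]].
under eq_bigr => j _ do rewrite turnL //.
rewrite -(big_mkord xpredT (fun j => L j.+1 - L j)) telescope_sumr //.
have -> : L 0%N = 0 by rewrite /L leg1.
have -> : L (3 * M)%N = -3; last by [].
rewrite /L leqNgt ltn_pmul2r //=.
rewrite /q (_ : x _ = 3); last by rewrite /x natrM mulfK // lt0r_neq0.
rewrite tri_loop3; last by lra.
by rewrite /colour /=; case: ltP => // ?; exfalso; lra.
Qed.

End Hole.

(** * Convex polygons as lists of half-planes *)

Section Poly.
Context {R : realType}.
Implicit Types (h : R * R * R) (s : seq (R * R * R)) (p c : R * R).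

(* The triple h stands for the open half-plane 0 < h.1.1 x + h.1.2 y + h.2. *)
Fixpoint polygon s : set (R * R) := fun p =>
  if s is h :: s' then 0 < h.1.1 * p.1 + h.1.2 * p.2 + h.2 /\ polygon s' p else True.

Lemma polygon_open s : open (polygon s).
Proof.
elim: s => [|h s IH]; first exact: openT.
apply: openI => //; pose f (p : R * R) := h.1.1 * p.1 + h.1.2 * p.2 + h.2.
apply: (@open_comp _ _ f [set x | 0 < x]); last exact: open_gt.
move=> p _; apply: cvgD; last exact: cvg_cst.
by apply: cvgD; apply: cvgM; (try exact: cvg_cst); [exact: cvg_fst|exact: cvg_snd].
Qed.

Lemma polygon_star s c : polygon s c -> star (polygon s) c.
Proof.
move=> sc; split => // p t /andP[t0 t1] sp.
elim: s sc sp => //= -[[x y] z] s IH /= [c0 sc] [p0 sp]; split; last exact: IH.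
have [->|tn] := eqVneq t 0; first by rewrite !scale0r !addr0.
have tp : 0 < t by rewrite lt0r tn.
have -> : x * (p.1 + t *: (c.1 - p.1)) + y * (p.2 + t *: (c.2 - p.2)) + z =
  (1 - t) * (x * p.1 + y * p.2 + z) + t * (x * c.1 + y * c.2 + z).
  by rewrite /GRing.scale /=; ring.
by apply: ltr_wpDl; [rewrite mulr_ge0 ?subr_ge0 // ltW|rewrite mulr_gt0].
Qed.

Lemma star_cover (S : set (R * R)) c : S c ->
  (forall p, S p -> exists P, [/\ P p, star P c & P `<=` S]) -> star S c.
Proof.
move=> Sc h; split=> // p t t01 /h[P [Pp [_ Pst] PS]].
by apply: PS; exact: Pst.
Qed.

End Poly.

(** * Lines, rim, comb and net *)

Section Configuration.
Context {R : realType} (Q : int).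
Hypothesis Q1 : 1 <= Q.

Let q : R := Q%:~R.

Let q1 : 1 <= q. Proof. by move: Q1; rewrite -(ler_int R). Qed.

Let leR (x y : int) : x <= y -> x%:~R <= y%:~R :> R.
Proof. by rewrite ler_int. Qed.

(** The passage from geometry to integers: linear real arithmetic shows that an integral combination
    of indices is positive, and integrality improves this to at least 1. *)
Let pos_int (x : int) : 0 < x%:~R :> R -> 1 <= x.
Proof. by rewrite ltr0z; lia. Qed.

Notation mm := (Q + Q + Q + 1).

(* A point (a, b) carries a third coordinate c = 3/2 - a - b, and the three
   walls are a = b, b = c and c + m = a with m = 3 Q + 1. *)
Definition frame : seq (R * R * R) :=
  [:: (1, -1, 1/2); (1, 2, -3/2 + 1/2); (-2, -1, 3/2 + (3 * q + 1) + 1/2)].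

(* Arm (e, k) r is the part of the strip of radius r around the line where the
   coordinate number e equals k that lies on the inner side of the wall where the
   other two coordinates agree. *)
Definition Arm (z : nat * int) (r : R) : set (R * R) :=
  polygon (match z.1 with
  | 0%N => [:: (1, 0, r - z.2%:~R); (-1, 0, r + z.2%:~R); (1, 2, -3/2 - 2/5)]
  | 1%N => [:: (0, 1, r - z.2%:~R); (0, -1, r + z.2%:~R);
               (-2, -1, 3/2 + (3 * q + 1) - 2/5)]
  | _ => [:: (-1, -1, 3/2 + r - z.2%:~R); (1, 1, -3/2 + r + z.2%:~R); (1, -1, -2/5)]
  end ++ frame).

Lemma chart_same e i j p : Arm (e, i) (1/5) p -> Arm (e, j) (1/5) p -> i = j.
Proof.
move=> h h'; suff : [/\ 1 <= i - j + 1 & 1 <= j - i + 1] by move=> []; lia.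
rewrite /Arm /= in h h'.
by split; apply: pos_int; rewrite rmorphD rmorphB /=;
  case: e h h' => [|[|e]] /=; lra.
Qed.

(* arms_meet z z' decides whether two arms intersect: the inequalities say that the
   point where both coordinates are integers lies in both arms. *)
Definition m01 (i j : int) := [&& j <= i, 2 <= i + j + j & i + i + j <= Q + Q + Q + 2].
Definition m02 (i k : int) :=
  [&& i <= k + (Q + Q + Q + 1), i + k + k <= 1 & 2 <= i + i + k].
Definition m12 (j k : int) :=
  [&& k <= j, 1 <= j + k + k + (Q + Q + Q) & j + j + k <= 1].

Definition arms_meet (z z' : nat * int) : bool :=
  match z.1, z'.1 with
  | 0%N, 1%N => m01 z.2 z'.2 | 1%N, 0%N => m01 z'.2 z.2
  | 0%N, 2%N => m02 z.2 z'.2 | 2%N, 0%N => m02 z'.2 z.2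
  | 1%N, 2%N => m12 z.2 z'.2 | 2%N, 1%N => m12 z'.2 z.2
  | _, _ => z == z'
  end.

(** Rounding [p] to the crossing [(i, j)] preserves all the constraints. At the wall shared by both
    arms the error stays below [1/2 + 2/5 < 1]. At a wall where an arm ends, the crossing has
    half-integral distance and rounding costs [3/5], of which [2/5] is paid by the early stop; the
    rest is less than [1/2]. *)
Lemma chart01 i j p : Arm (0%N, i) (1/5) p -> Arm (1%N, j) (1/5) p -> m01 i j.
Proof.
rewrite /Arm /= => h h'.
suff : [/\ 1 <= i - j + 1, 1 <= i + j + j - 1 & 1 <= Q + Q + Q + 1 + 1 + 1 - i - i - j].
  by move=> {h h'} []; rewrite /m01; lia.
by split; apply: pos_int; rewrite !(rmorphD, rmorphB) /=; rewrite -/q; lra.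
Qed.

Lemma chart02 i k p : Arm (0%N, i) (1/5) p -> Arm (2%N, k) (1/5) p -> m02 i k.
Proof.
rewrite /Arm /= => h h'.
suff : [/\ 1 <= k + (Q + Q + Q + 1) - i + 1, 1 <= 1 + 1 - i - k - k & 1 <= i + i + k - 1].
  by move=> {h h'} []; rewrite /m02; lia.
by split; apply: pos_int; rewrite !(rmorphD, rmorphB) /=; rewrite -/q; lra.
Qed.

Lemma chart12 j k p : Arm (1%N, j) (1/5) p -> Arm (2%N, k) (1/5) p -> m12 j k.
Proof.
rewrite /Arm /= => h h'.
suff : [/\ 1 <= j - k + 1, 1 <= j + k + k + (Q + Q + Q) & 1 <= 1 + 1 - j - j - k].
  by move=> {h h'} []; rewrite /m12; lia.
by split; apply: pos_int; rewrite !(rmorphD, rmorphB) /=; rewrite -/q; lra.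
Qed.

Definition isdir (z : nat * int) := (z.1 < 3)%N.

Lemma arms_meetP z z' p : isdir z -> isdir z' -> Arm z (1/5) p -> Arm z' (1/5) p -> arms_meet z z'.
Proof.
move: z z' => [[|[|[|e]]] i] [[|[|[|e']]] j] // _ _ h h'; rewrite /arms_meet /=;
  by [rewrite (chart_same h h')|exact: chart01 h h'|exact: chart02 h h'
     |exact: chart12 h h'|exact: chart01 h' h|exact: chart02 h' h|exact: chart12 h' h].
Qed.

Definition vtx (z z' : nat * int) : R * R :=
  match z.1, z'.1 with
  | 0%N, 1%N => (z.2%:~R, z'.2%:~R) | 1%N, 0%N => (z'.2%:~R, z.2%:~R)
  | 0%N, 2%N => (z.2%:~R, 3/2 - z.2%:~R - z'.2%:~R)
  | 2%N, 0%N => (z'.2%:~R, 3/2 - z.2%:~R - z'.2%:~R)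
  | 1%N, 2%N => (3/2 - z.2%:~R - z'.2%:~R, z.2%:~R)
  | _, _ => (3/2 - z.2%:~R - z'.2%:~R, z'.2%:~R)
  end.

Lemma vtx01 i j r : 0 < r -> m01 i j ->
  Arm (0%N, i) r (i%:~R, j%:~R) /\ Arm (1%N, j) r (i%:~R, j%:~R).
Proof.
move=> r0 /and3P[/leR h1 /leR h2 /leR h3]; rewrite !rmorphD /= -/q in h2 h3.
by rewrite /Arm /= -/q; lra.
Qed.

Lemma vtx02 i k r : 0 < r -> m02 i k ->
  Arm (0%N, i) r (i%:~R, 3/2 - i%:~R - k%:~R) /\
  Arm (2%N, k) r (i%:~R, 3/2 - i%:~R - k%:~R).
Proof.
move=> r0 /and3P[/leR h1 /leR h2 /leR h3]; rewrite !rmorphD /= -/q in h1 h2 h3.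
by rewrite /Arm /= -/q; lra.
Qed.

Lemma vtx12 j k r : 0 < r -> m12 j k ->
  Arm (1%N, j) r (3/2 - j%:~R - k%:~R, j%:~R) /\
  Arm (2%N, k) r (3/2 - j%:~R - k%:~R, j%:~R).
Proof.
move=> r0 /and3P[/leR h1 /leR h2 /leR h3]; rewrite !rmorphD /= -/q in h2 h3.
by rewrite /Arm /= -/q; lra.
Qed.

Lemma vtxP z z' r : isdir z -> isdir z' -> z.1 != z'.1 -> 0 < r -> arms_meet z z' ->
  Arm z r (vtx z z') /\ Arm z' r (vtx z z').
Proof.
move: z z' => [[|[|[|e]]] i] [[|[|[|e']]] j] //= _ _ _ r0; rewrite /arms_meet /vtx /= => h.
- exact: vtx01.
- exact: vtx02.
- by have [] := vtx01 r0 h.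
- exact: vtx12.
- by have [] := vtx02 r0 h; rewrite addrAC.
- by have [] := vtx12 r0 h; rewrite addrAC.
Qed.

(* The line with index l reaches a wall where two coordinates are l modulo m;
   it consists of the two arms leaving from there. *)
Definition isarm (l : int) (z : nat * int) : bool :=
  match z.1 with
  | 0%N => (1 <= l) && (z.2 == l)
  | 1%N => (l <= Q) && (z.2 == l)
  | 2%N => (l <= 0) && (z.2 == l) || (Q + 1 <= l) && (z.2 == l - (Q + Q + Q + 1))
  | _ => false
  end.

Definition idx (l : int) : bool := 1 - Q <= l <= Q + Q + 1.

Lemma isarm_dir l z : isarm l z -> isdir z.
Proof. by case: z => [[|[|[|e]]] i]. Qed.

Lemma isarmE l z : isarm l z -> [\/ z = (0%N, l) /\ 1 <= l, z = (1%N, l) /\ l <= Q,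
  z = (2%N, l) /\ l <= 0 | z = (2%N, l - (Q + Q + Q + 1)) /\ Q + 1 <= l].
Proof.
case: z => [[|[|[|e]]] i] //; rewrite /isarm /=.
- by move=> /andP[h /eqP->]; apply: Or41.
- by move=> /andP[h /eqP->]; apply: Or42.
- by move=> /orP[]/andP[h /eqP->]; [apply: Or43|apply: Or44].
Qed.

(** Two lines have four pairs of arms, exactly one of which crosses. The thresholds are the
    inequalities of [arms_meet] that separate one crossing pair from the next as the indices
    grow. *)
Definition pick_pair (l l' : int) : (nat * int) * (nat * int) :=
  if l' + l' + l <= 1 then ((2%N, l), (1%N, l'))
  else if l + l + l' <= 1 then ((2%N, l), (0%N, l'))
  else if l' + l' + l <= Q + Q + Q + 2 then ((1%N, l), (0%N, l'))
  else if l + l + l' <= Q + Q + Q + 2 then ((1%N, l), (2%N, l' - (Q + Q + Q + 1)))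
  else ((0%N, l), (2%N, l' - (Q + Q + Q + 1))).

Lemma pick_pairP l l' : idx l -> idx l' -> l < l' ->
  let z := pick_pair l l' in
  [/\ isarm l z.1, isarm l' z.2, z.1.1 != z.2.1 & arms_meet z.1 z.2].
Proof.
move: Q1; clear; rewrite /idx /pick_pair => Q1 il il' ll'.
by repeat (case: ifP => ?); rewrite /isarm /arms_meet /m01 /m02 /m12 /= ?eqxx; split; lia.
Qed.

Lemma pick_pair_unique l l' y y' : idx l -> idx l' -> l < l' ->
  isarm l y -> isarm l' y' -> arms_meet y y' -> (y, y') = pick_pair l l'.
Proof.
move: Q1; clear => Q1; rewrite /idx => il il' ll' /isarmE hy /isarmE hy'.
by case: hy => -[-> h1]; case: hy' => -[-> h2];
  rewrite /arms_meet /m01 /m02 /m12 /pick_pair /= ?xpair_eqE /= => h3;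
  repeat (case: ifP => ?); try reflexivity; exfalso; lia.
Qed.

Lemma Arm_mono z r r' : r <= r' -> Arm z r `<=` Arm z r'.
Proof. by move: z => [[|[|e]] k] rr' [x y]; rewrite /Arm /=; lra. Qed.

Lemma Arm_sum i j k p : Arm (0%N, i) (1/5) p -> Arm (1%N, j) (1/5) p ->
  Arm (2%N, k) (1/5) p -> 1 <= i + j + k <= 2.
Proof.
rewrite /Arm /= => h h' h''.
suff : 1 <= i + j + k /\ 1 <= 1 + 1 + 1 - i - j - k by move=> {h h' h''} []; lia.
by split; apply: pos_int; rewrite !(rmorphD, rmorphB) /=; lra.
Qed.

Lemma Arm_sum_thin e i j k p : Arm (0%N, i) (1/5) p -> Arm (1%N, j) (1/5) p ->
  Arm (2%N, k) (1/5) p -> forall l, Arm (e, l) (1/10) p -> (e < 3)%N -> False.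
Proof.
move=> h h' h'' l hl e3; have s := Arm_sum h h' h''.
have {}s : (i + j + k)%:~R = 1 :> R \/ (i + j + k)%:~R = 2 :> R.
  have [->|->] : i + j + k = 1 \/ i + j + k = 2 by move: s; clear; lia.
    by left.
  by right.
rewrite !rmorphD /= in s.
have hl' : Arm (e, l) (1/5) p by apply: Arm_mono hl; lra.
case: e e3 hl hl' => [|[|[|e]]] // _ hl hl'.
- have e1 := chart_same h hl'; subst l; move: hl h h' h''; rewrite /Arm /=; lra.
- have e1 := chart_same h' hl'; subst l; move: hl h h' h''; rewrite /Arm /=; lra.
- have e1 := chart_same h'' hl'; subst l; move: hl h h' h''; rewrite /Arm /=; lra.
Qed.

Definition wall (l : int) : nat := if l <= 0 then 1%N else if l <= Q then 0%N else 2%N.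

(* The foot of the line l on its wall, pushed across the wall by e. *)
Definition ctr (l : int) (e : R) : R * R :=
  if l <= 0 then (3/2 - 2 * l%:~R, l%:~R - e)
  else if l <= Q then (l%:~R - e, l%:~R + e)
  else (l%:~R + e, 3/2 + (3 * q + 1) - 2 * l%:~R).

Lemma region l : idx l ->
  [\/ [/\ l <= 0, wall l = 1%N, ctr l = fun e => (3/2 - 2 * l%:~R, l%:~R - e) : R * R,
          1 - q <= (l%:~R : R) <= 0
        & forall z, isarm l z -> z = (1%N, l) \/ z = (2%N, l)],
      [/\ 1 <= l <= Q, wall l = 0%N, ctr l = fun e => (l%:~R - e, l%:~R + e) : R * R,
          1 <= (l%:~R : R) <= q
        & forall z, isarm l z -> z = (0%N, l) \/ z = (1%N, l)]
    | [/\ Q + 1 <= l, wall l = 2%N,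
          ctr l = fun e => (l%:~R + e, 3/2 + (3 * q + 1) - 2 * l%:~R) : R * R,
          q + 1 <= (l%:~R : R) <= 2 * q + 1
        & forall z, isarm l z -> z = (0%N, l) \/ z = (2%N, l - (Q + Q + Q + 1))]].
Proof.
move=> /andP[l1 l2].
have r1 := leR l1; have r2 := leR l2; rewrite !(rmorphB, rmorphD) /= -/q in r1 r2.
rewrite /wall /ctr; case: (lerP l 0) => h0; last case: (lerP l Q) => h1.
- apply: Or31; split=> // [|z /isarmE]; first by have := leR h0; lra.
  by case=> -[-> h]; [move: h h0; clear; lia|left|right|move: Q1 h h0; clear; lia].
- apply: Or32; split=> // [|| z /isarmE]; first by move: h0 h1; clear; lia.
    have h0' : 1 <= l by move: h0; clear; lia.
    by have := leR h0'; have := leR h1; rewrite -/q; lra.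
  by case=> -[-> h]; [left|right|move: h h0; clear; lia|move: h h1; clear; lia].
- have h1' : Q + 1 <= l by move: h1; clear; lia.
  apply: Or33; split=> // [|z /isarmE].
    by have := leR h1'; rewrite rmorphD /= -/q; lra.
  by case=> -[-> h]; [left|move: h h1; clear; lia|move: h h0; clear; lia|right].
Qed.

Lemma ctr_arm l z e r : idx l -> isarm l z -> 0 <= e <= 4/25 -> e < r ->
  Arm z r (ctr l e).
Proof.
move=> /region h zl e0 er.
by case: h => -[_ _ -> h /(_ _ zl)[]->]; rewrite /Arm /= ?(rmorphB, rmorphD) /= -/q; lra.
Qed.

(* Strips lying just across the three walls; the first two are cut short at both
   ends so that each line meets only the strip across its own wall. *)
Definition Strip (e : nat) : set (R * R) :=
  polygon (match e with
  | 0%N => [:: (-1, 1, 0); (-1, 0, q + 1 - 1/5); (0, 1, -3/5)]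
  | 1%N => [:: (-1, -2, 3/2); (-1, -1, 3/2 + q - 1/5); (0, -1, 2/5)]
  | _ => [:: (2, 1, -3/2 - (3 * q + 1))]
  end ++ frame).

Lemma arm_strip l z p e : idx l -> isarm l z -> Arm z (1/5) p -> (e < 3)%N ->
  Strip e p -> e = wall l.
Proof.
move=> /region h zl.
by case: h => -[_ -> _ h /(_ _ zl)[]->]; rewrite /Arm /Strip /= ?(rmorphB, rmorphD) /= -/q;
  case: e => [|[|[|e]]] //= h' _ h''; exfalso; lra.
Qed.

Lemma ctr_strip l e : idx l -> 0 < e <= 4/25 -> Strip (wall l) (ctr l e).
Proof.
by move=> /region[]-[_ -> -> h _ he]; rewrite /Strip /= -/q; lra.
Qed.

Lemma arm_inj l l' z : idx l -> idx l' -> isarm l z -> isarm l' z -> l = l'.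
Proof.
move=> il il'; move: il il' Q1; rewrite /idx /isarm; clear => il il' Q1.
by case: z => [[|[|[|e]]] i] //=; lia.
Qed.

Definition inner (p : R * R) :=
  [/\ p.2 < p.1, 3/2 < p.1 + 2 * p.2 & 2 * p.1 + p.2 < 3/2 + (3 * q + 1)].

Lemma strip_inner e p : Strip e p -> ~ inner p.
Proof. by rewrite /inner /Strip; case: e => [|[|e]] /= h []; rewrite -/q in h *; lra. Qed.

Lemma inner01 (i j : int) p : j + 1 <= i -> Arm (0%N, i) (1/5) p -> Arm (1%N, j) (1/5) p -> inner p.
Proof.
by move=> /leR; rewrite rmorphD /inner /Arm /= -/q => ? ? ?; split; lra.
Qed.

Lemma inner02 (i k : int) p : i + 1 <= k + (Q + Q + Q + 1) ->
  Arm (0%N, i) (1/5) p -> Arm (2%N, k) (1/5) p -> inner p.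
Proof.
by move=> /leR; rewrite !rmorphD /inner /Arm /= -/q => ? ? ?; split; lra.
Qed.

Lemma inner12 (j k : int) p : k + 1 <= j ->
  Arm (1%N, j) (1/5) p -> Arm (2%N, k) (1/5) p -> inner p.
Proof.
by move=> /leR; rewrite rmorphD /inner /Arm /= -/q => ? ? ?; split; lra.
Qed.

Lemma pair_dir l l' z z' p : idx l -> idx l' -> l != l' ->
  isarm l z -> isarm l' z' -> Arm z (1/5) p -> Arm z' (1/5) p -> z.1 != z'.1.
Proof.
move=> il il' ll' zl zl' zp zp'; apply: contraNneq ll' => ezz.
suff e : z = z' by rewrite (arm_inj il il' zl) // e.
move: z z' zp zp' ezz {zl zl'} => [e i] [e' j] /= + + ee; subst e' => h h'.
by rewrite (chart_same h h').
Qed.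

(** Equality in the wall condition of [arms_meet] would mean two arms with the same foot, hence a
    single line. For distinct lines the relevant integers differ by at least 1, more than the total
    width [2/5], so the crossing stays strictly inside. *)
Lemma pair_inner l l' z z' p : idx l -> idx l' -> l != l' ->
  isarm l z -> isarm l' z' -> Arm z (1/5) p -> Arm z' (1/5) p -> inner p.
Proof.
move=> il il' ll' zl zl' zp zp'; have zz := pair_dir il il' ll' zl zl' zp zp'.
have := arms_meetP (isarm_dir zl) (isarm_dir zl') zp zp'.
move: il il' ll' zl zl' zp zp' zz Q1; rewrite /idx /isarm /arms_meet.
case: z => [[|[|[|e]]] i] //; case: z' => [[|[|[|e']]] j] //=;
  rewrite ?eqxx // /m01 /m02 /m12 => il il' ll' zl zl' zp zp' _ Q1' h.
- by apply: (inner01 _ zp zp'); move: il il' ll' zl zl' Q1' h; clear; lia.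
- by apply: (inner02 _ zp zp'); move: il il' ll' zl zl' Q1' h; clear; lia.
- by apply: (inner01 _ zp' zp); move: il il' ll' zl zl' Q1' h; clear; lia.
- by apply: (inner12 _ zp zp'); move: il il' ll' zl zl' Q1' h; clear; lia.
- by apply: (inner02 _ zp' zp); move: il il' ll' zl zl' Q1' h; clear; lia.
- by apply: (inner12 _ zp' zp); move: il il' ll' zl zl' Q1' h; clear; lia.
Qed.

(* A tooth fills part of the face between a wall and the lines t and t + 1. *)
Definition tidx (t : int) : bool := (- Q <= t <= Q + Q) && (t != 0).

Definition twall (t : int) : nat := if t < 0 then 1%N else if t <= Q then 0%N else 2%N.

Definition Tooth (t : int) : set (R * R) :=
  polygon ((if t < 0 then [:: (0, -1, t%:~R + 1 - 3/20); (-1, -1, 3/2 - t%:~R - 3/20)]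
    else if t <= Q then [:: (-1, 0, t%:~R + 1 - 3/20); (0, 1, - t%:~R - 3/20)]
    else [:: (1, 1, t%:~R + 1 - 3/20 - 3/2 - (3 * q + 1)); (1, 0, - t%:~R - 3/20)])
    ++ frame).

(** For [t = Q] and [t = - Q] the point must lie in the tooth and in both strips that overlap at
    that corner, since it also serves as a centre of these strips. At [t = Q] this asks for a first
    coordinate below [q + 4/5] and for twice it plus the second above [3 * q + 5/2], a narrow window
    containing the values chosen. *)
Definition tctr (t : int) : R * R :=
  if t < 0 then (3/2 - 2 * t%:~R - 6/25, t%:~R + 1/50)
  else if t <= Q then (t%:~R + 39/50, t%:~R + 49/50)
  else (t%:~R + 49/50, 3/2 + (3 * q + 1) - 2 * t%:~R - 44/25).

Lemma tregion t : tidx t ->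
  [\/ [/\ - Q <= t <= -1, twall t = 1%N, - q <= (t%:~R : R) <= -1,
          tctr t = (3/2 - 2 * t%:~R - 6/25, t%:~R + 1/50)
        & Tooth t = polygon ([:: (0, -1, t%:~R + 1 - 3/20); (-1, -1, 3/2 - t%:~R - 3/20)]
                             ++ frame)],
      [/\ 1 <= t <= Q, twall t = 0%N, 1 <= (t%:~R : R) <= q,
          tctr t = (t%:~R + 39/50, t%:~R + 49/50)
        & Tooth t = polygon ([:: (-1, 0, t%:~R + 1 - 3/20); (0, 1, - t%:~R - 3/20)]
                             ++ frame)]
    | [/\ Q + 1 <= t <= Q + Q, twall t = 2%N, q + 1 <= (t%:~R : R) <= 2 * q,
          tctr t = (t%:~R + 49/50, 3/2 + (3 * q + 1) - 2 * t%:~R - 44/25)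
        & Tooth t = polygon ([:: (1, 1, t%:~R + 1 - 3/20 - 3/2 - (3 * q + 1));
                               (1, 0, - t%:~R - 3/20)] ++ frame)]].
Proof.
rewrite /tidx /twall /tctr /Tooth => /andP[/andP[t1 t2] t0].
have r1 := leR t1; have r2 := leR t2; rewrite !(rmorphN, rmorphD) /= -/q in r1 r2.
case: (ltrP t 0) => h0; last case: (lerP t Q) => h1.
- have h : t <= -1 by move: h0; clear; lia.
  apply: Or31; split=> //; first by apply/andP; split.
  by have := leR h; rewrite rmorphN /=; lra.
- have h : 1 <= t by move: h0 t0; clear; lia.
  apply: Or32; split=> //; first by apply/andP; split.
  by have := leR h; have := leR h1; rewrite -/q; lra.
- have h : Q + 1 <= t by move: h1; clear; lia.
  apply: Or33; split=> //; first by apply/andP; split.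
  by have := leR h; rewrite rmorphD /= -/q; lra.
Qed.

Lemma tctr_tooth t : tidx t -> Tooth t (tctr t) /\ Strip (twall t) (tctr t).
Proof.
by move=> /tregion[] [_ -> h -> ->]; rewrite /Strip /= -/q; lra.
Qed.

Lemma tooth_strip t e p : tidx t -> (e < 3)%N -> Tooth t p -> Strip e p ->
  Strip e (tctr t).
Proof.
move=> it e3; have [_] := tctr_tooth it; move: e e3.
case: (tregion it) => -[bt -> h -> ->] [|[|[|e]]] //= _ //; rewrite /Strip /= -/q => hc hp hs;
  try by clear bt hc; exfalso; lra.
- have : 1 <= 1 - Q - t.
    by apply: pos_int; rewrite !(rmorphB) /= -/q; lra.
  move=> bt'; have {bt bt'} -> : t = - Q by move: bt bt'; clear; lia.
  by rewrite rmorphN /= -/q; lra.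
- have : 1 <= 1 - Q + t.
    by apply: pos_int; rewrite !(rmorphB, rmorphD) /= -/q; lra.
  move=> bt'; have {bt bt'} -> : t = Q by move: bt bt'; clear; lia.
  by rewrite -/q; lra.
Qed.

Lemma tooth_tooth t t' p : tidx t -> tidx t' -> t != t' ->
  Tooth t p -> Tooth t' p -> exists2 e, (e < 3)%N & Strip e p.
Proof.
wlog tt : t t' / t + 1 <= t'.
  move=> wl it it' ne tp tp'.
  have [h|h] : t + 1 <= t' \/ t' + 1 <= t by move: ne; clear; lia.
    exact: (wl t t').
  by apply: (wl t' t) => //; rewrite eq_sym.
move=> it it' _ tp tp'; have {}tt := leR tt; rewrite rmorphD /= in tt.
exists (twall t); first by rewrite /twall; case: ifP => // _; case: ifP.
move: (tregion it) (tregion it') tp tp' => ht ht'.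
case: ht => -[_ -> rt _ ->]; case: ht' => -[_ _ rt' _ ->];
  rewrite /Strip /= -/q => h h'; try lra; exfalso; lra.
Qed.

(* An arm ending on the wall of a tooth stays away from it: there the coordinate
   of the arm is close to a half-integer. *)
Lemma arm_tooth_side e k t p : tidx t -> Arm (e, k) (1/5) p -> Tooth t p ->
  twall t = (e.+1 %% 3)%N -> (e < 3)%N -> False.
Proof.
move=> it hz hp ew e3.
suff [n [h1 h2]] : exists n : int, 1 <= n + 1 /\ 1 <= - n.
  by move: h1 h2; clear; lia.
move: hz hp ew e3; case: (tregion it) => -[_ -> rt _ ->];
  case: e => [|[|[|e]]] // hz hp _ _; rewrite /Arm /= -/q in hz hp.
- exists (- t - t - k).
  by split; apply: pos_int; rewrite !(rmorphB, rmorphN, rmorphD) /=; lra.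
- exists (- t - t - k).
  by split; apply: pos_int; rewrite !(rmorphB, rmorphN, rmorphD) /=; lra.
- exists (Q + Q + Q + 1 - t - t - k).
  by split; apply: pos_int; rewrite !(rmorphB, rmorphN, rmorphD) /= -/q; lra.
Qed.

Lemma arm_tooth l z t p : idx l -> isarm l z -> tidx t ->
  Arm z (1/5) p -> Tooth t p ->
  [\/ [/\ t <= l <= t + 1, wall l = twall t & Tooth t (ctr l (4/25))],
      [/\ t = Q, l = Q + 1 & z = (0%N, l)]
    | [/\ t = - Q, l = Q + Q + 1 & z = (2%N, - Q)]].
Proof.
move=> il zl it hz hp; have ht := tregion it.
have [ew|ew] := eqVneq (wall l) (twall t).
  apply: Or31.
  have tl : t <= l <= t + 1.
    suff [h1 h2] : 1 <= l - t + 1 /\ 1 <= t + 1 + 1 - l by move: h1 h2; clear; lia.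
    move: hz hp ew; case: (region il) => -[_ -> _ rl /(_ _ zl)[]->];
    case: ht => -[_ -> rt _ ->] //; rewrite /Arm /= -/q ?rmorphB ?rmorphD /= => hz hp _;
    by split; apply: pos_int; rewrite !(rmorphB, rmorphD) /=; lra.
  split=> //; have /andP[/leR h /leR h'] := tl; rewrite rmorphD /= in h'.
  move: ew; case: (region il) => -[_ -> -> rl _];
  by case: ht => -[_ -> rt _ ->] //= _; rewrite -/q; clear tl; lra.
move: hz hp ew; case: (region il) => -[bl -> _ rl /(_ _ zl)[]->];
  case: ht => -[bt ew rt _ eT]; rewrite ew // => hz hp _;
  try (by case: (arm_tooth_side it hz hp ew));
  rewrite eT in hp; clear eT ew; rewrite /Arm /= -/q ?rmorphB ?rmorphD /= in hz hp.
- by clear bl bt; exfalso; lra.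
- by clear bl bt; exfalso; lra.
- by clear bl bt; exfalso; lra.
- by clear bl bt; exfalso; lra.
- have h1 : 1 <= t - Q + 1 by apply: pos_int; rewrite !(rmorphB, rmorphD) /= -/q; lra.
  have h2 : 1 <= Q + 1 - l + 1 by apply: pos_int; rewrite !(rmorphB, rmorphD) /= -/q; lra.
  by apply: Or32; split=> //; move: bt bl h1 h2; clear; lia.
- have h1 : 1 <= 1 - Q - t by apply: pos_int; rewrite !(rmorphB) /= -/q; lra.
  have h2 : 1 <= l - Q - Q by apply: pos_int; rewrite !(rmorphB) /= -/q; lra.
  move: il; rewrite /idx => /andP[_ h3].
  apply: Or33; split; [| |congr pair]; move: bt bl h1 h2 h3; clear; lia.
Qed.

(** The edges of a tooth run [3/20] away from the two lines of its face, further than the radius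
    [1/10]; so a thin line can meet the tooth only where the tooth continues across the wall. *)
Lemma thin_tooth l z t p : idx l -> isarm l z -> tidx t ->
  Arm z (1/10) p -> Tooth t p -> Strip (twall t) p.
Proof.
move=> il zl it hz hp.
have hz' : Arm z (1/5) p by apply: Arm_mono hz; lra.
case: (arm_tooth il zl it hz' hp) => [[tl ew _]|[? ? ?]|[? ? ?]]; last first.
- subst t l z; have := tregion it; move: hz hp {hz' zl il}.
  by move=> hz hp [] [bt -> rt _ eT]; rewrite eT /Arm /= -/q rmorphN /= -/q in hz hp rt;
    clear bt eT; exfalso; lra.
- subst t l z; have := tregion it; move: hz hp {hz' zl il}.
  by move=> hz hp [] [bt -> rt _ eT]; rewrite eT /Arm /= rmorphD /= -/q in hz hp rt;
    clear bt eT; exfalso; lra.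
have {}tl : l%:~R = t%:~R :> R \/ l%:~R = t%:~R + 1 :> R.
  have [->|->] : l = t \/ l = t + 1 by move: tl; clear; lia.
    by left.
  by right; rewrite rmorphD.
move: ew hz hp {hz'}; rewrite /Strip.
case: (region il) => -[_ -> _ rl /(_ _ zl)[]->];
case: (tregion it) => -[_ -> rt _ ->] // _;
rewrite /Arm /= -/q ?rmorphB ?rmorphD /= => hz hp;
case: tl => e; rewrite e in hz rl; (lra || (exfalso; lra)).
Qed.

(* The two lines bounding the face of the tooth t, in increasing order. *)
Definition lo (t : int) : int := if t == - Q then 1 - Q else t.
Definition hi (t : int) : int := if t == - Q then Q + Q + 1 else t + 1.

(** Indices count modulo [mm]: the neighbour [- Q] of the line [1 - Q] is the line [Q + Q + 1],
    which accounts for the exceptional values of [lo] and [hi]. *)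
Lemma pair_tooth l l' z z' t p : idx l -> idx l' -> l < l' ->
  isarm l z -> isarm l' z' -> tidx t ->
  Arm z (1/5) p -> Arm z' (1/5) p -> Tooth t p -> l = lo t /\ l' = hi t.
Proof.
move=> il il' ll' zl zl' it hz hz' hp.
have e1 : t <= l <= t + 1 \/ t = - Q /\ l = Q + Q + 1 \/ t = Q /\ l = Q + 1.
  case: (arm_tooth il zl it hz hp) => [[? _ _]|[? ? _]|[? ? _]].
  - by left.
  - by right; right.
  - by right; left.
have e2 : t <= l' <= t + 1 \/ t = - Q /\ l' = Q + Q + 1 \/ t = Q /\ l' = Q + 1.
  case: (arm_tooth il' zl' it hz' hp) => [[? _ _]|[? ? _]|[? ? _]].
  - by left.
  - by right; right.
  - by right; left.
move: il il' ll' it e1 e2 Q1; rewrite /idx /tidx /lo /hi; clear => *.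
by case: eqP => h; split; lia.
Qed.

(** The witness is taken near the crossing of the two lines, off each by [17/100]: beyond the margin
    [3/20] of the tooth, yet within the radius [1/5]. *)
Lemma tooth_vertex t : tidx t -> exists p z z',
  [/\ isarm (lo t) z, isarm (hi t) z', Arm z (1/5) p, Arm z' (1/5) p & Tooth t p].
Proof.
move=> it; case: (tregion it) => -[bt _ rt _ ->].
- exists (3/2 - 2 * t%:~R - 1, t%:~R + 83/100).
  have [e|e] := eqVneq t (- Q).
    exists (1%N, t + 1), (2%N, t); rewrite /isarm /lo /hi e eqxx /=.
    split; try (by move: Q1; clear; lia);
      by rewrite /Arm /= ?rmorphD ?rmorphN /= -/q in rt *; subst t;
        rewrite rmorphN /= -/q in rt *; clear bt; lra.
  exists (2%N, t), (1%N, t + 1); rewrite /isarm /lo /hi (negbTE e) /=.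
  split; try (by move: Q1 bt; clear; lia);
    by rewrite /Arm /= ?rmorphD /= -/q; clear bt; lra.
- exists (t%:~R + 83/100, t%:~R + 17/100), (1%N, t), (0%N, t + 1).
  have e : t == - Q = false by move: Q1 bt; clear; lia.
  rewrite /isarm /lo /hi e /=.
  split; try (by move: Q1 bt; clear; lia);
    by rewrite /Arm /= ?rmorphD /= -/q; clear bt; lra.
- exists (t%:~R + 17/100, 3/2 + (3 * q + 1) - 2 * t%:~R - 1), (0%N, t), (2%N, t + 1 - mm).
  have e : t == - Q = false by move: Q1 bt; clear; lia.
  rewrite /isarm /lo /hi e /=.
  split; try (by move: Q1 bt; clear; lia);
    by rewrite /Arm /= ?rmorphB ?rmorphD /= -/q; clear bt; lra.
Qed.

(** Arms of distinct lines through one point have distinct directions, so all three directions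
    occur. Only an arm of direction 2 may carry an index lowered by [mm], and this happens at most
    once. *)
Lemma three_arms l l' l'' z z' z'' p : idx l -> idx l' -> idx l'' ->
  l != l' -> l != l'' -> l' != l'' ->
  isarm l z -> isarm l' z' -> isarm l'' z'' ->
  Arm z (1/5) p -> Arm z' (1/5) p -> Arm z'' (1/5) p ->
  exists i j k, [/\ Arm (0%N, i) (1/5) p, Arm (1%N, j) (1/5) p, Arm (2%N, k) (1/5) p &
    l + l' + l'' = i + j + k \/ l + l' + l'' = i + j + k + mm].
Proof.
move=> il il' il'' n1 n2 n3 zl zl' zl'' hz hz' hz''.
have := pair_dir il il' n1 zl zl' hz hz'.
have := pair_dir il il'' n2 zl zl'' hz hz''.
have := pair_dir il' il'' n3 zl' zl'' hz' hz''.
have cl (u : int) e i : isarm u (e, i) -> u = i \/ e = 2%N /\ u = i + mm.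
  by clear; move=> /isarmE[] [[-> ->] h]; [left|left|left|right; split => //; lia].
have cl' (u : int) e i : (e < 2)%N -> isarm u (e, i) -> u = i.
  by move=> e2 /cl[->|[e3 _]] //; rewrite e3 in e2.
move: z z' z'' zl zl' zl'' hz hz' hz'' => [[|[|[|e]]] i] [[|[|[|e']]] i'] [[|[|[|e'']]] i''] //=
  zl zl' zl'' hz hz' hz'' // _ _ _.
- exists i, i', i''; split=> //; have := cl' l 0%N i isT zl; have := cl' l' 1%N i' isT zl'.
  by have := cl _ _ _ zl''; clear; lia.
- exists i, i'', i'; split=> //; have := cl' l 0%N i isT zl; have := cl' l'' 1%N i'' isT zl''.
  by have := cl _ _ _ zl'; clear; lia.
- exists i', i, i''; split=> //; have := cl' l' 0%N i' isT zl'; have := cl' l 1%N i isT zl.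
  by have := cl _ _ _ zl''; clear; lia.
- exists i'', i, i'; split=> //; have := cl' l'' 0%N i'' isT zl''; have := cl' l 1%N i isT zl.
  by have := cl _ _ _ zl'; clear; lia.
- exists i', i'', i; split=> //; have := cl' l' 0%N i' isT zl'; have := cl' l'' 1%N i'' isT zl''.
  by have := cl _ _ _ zl; clear; lia.
- exists i'', i', i; split=> //; have := cl' l'' 0%N i'' isT zl''; have := cl' l' 1%N i' isT zl'.
  by have := cl _ _ _ zl; clear; lia.
Qed.

Lemma triple_vertex l l' l'' : idx l -> idx l' -> idx l'' -> l < l' -> l' < l'' ->
  1 <= l + l' + l'' <= 2 \/ mm + 1 <= l + l' + l'' <= mm + 2 ->
  exists p z z' z'', [/\ isarm l z, isarm l' z', isarm l'' z'',
    Arm z (1/5) p & Arm z' (1/5) p /\ Arm z'' (1/5) p].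
Proof.
move=> il il' il'' ll' ll'' S.
suff [i [j [k [z1 z2 z3]]]] : exists i j k : int,
    [/\ [/\ j + 1 <= i, k + 1 <= j & i + 1 <= k + mm], 1 <= i + j + k <= 2 &
     [/\ isarm l'' (0%N, i), isarm l' (1%N, j) & isarm l (2%N, k)] \/
     [/\ isarm l' (0%N, i), isarm l (1%N, j) & isarm l'' (2%N, k)]].
  (* The defect [1/2] or [-1/2] of the sum is shared equally by the three coordinates, putting each
     one [1/6 < 1/5] away from its integer. *)
  pose d : R := (3/2 - (i + j + k)%:~R) / 3.
  have hd : - (1/6) <= d <= 1/6 /\ 3 * d + i%:~R + j%:~R + k%:~R = 3/2.
    rewrite /d; case/andP: z2 => /leR z2 /leR z2'.
    by rewrite !rmorphD /= in z2 z2' *; lra.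
  case: z1 => /leR z1 /leR z1' /leR z1''; rewrite !rmorphD /= -/q in z1 z1' z1''.
  have [h1 h2 h3] : [/\ Arm (0%N, i) (1/5) (i%:~R + d, j%:~R + d),
      Arm (1%N, j) (1/5) (i%:~R + d, j%:~R + d) & Arm (2%N, k) (1/5) (i%:~R + d, j%:~R + d)].
    by move: hd z1 z1' z1'' {z2 z3}; move: d => d hd ? ? ?; split; rewrite /Arm /= -/q; lra.
  exists (i%:~R + d, j%:~R + d).
  case: z3 => -[a1 a2 a3].
    by exists (2%N, k), (1%N, j), (0%N, i).
  by exists (1%N, j), (0%N, i), (2%N, k).
move: il il' il'' ll' ll'' S Q1; rewrite /idx /isarm /=; clear => il il' il'' ll' ll'' S Q1.
case: S => S.
(* For a sum 1 or 2 the directions decrease as the index grows; with an extra [mm] the largest index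
   is the one lowered by [mm], and its line uses direction 2. *)
- exists l'', l', l; split; last (left; split); try split; lia.
- exists l', l, (l'' - mm); split; last (right; split); try split; lia.
Qed.

Lemma int_range (a b : int) : exists s : seq int, forall x, (x \in s) = (a <= x <= b).
Proof.
exists [seq a + i%:Z | i <- iota 0 (if a <= b then `|b - a|%N.+1 else 0)] => x.
apply/mapP/idP => [[i]|xab].
  by rewrite mem_iota => h ->; move: h; clear; case: ifP; lia.
by exists `|x - a|%N; rewrite ?mem_iota; move: xab; clear; [case: ifP|]; lia.
Qed.

(** * Intersections of lines, rim, comb and net *)

Definition Line (l : int) (r : R) : set (R * R) :=
  [set p | exists2 z, isarm l z & Arm z r p].

Definition Rim : set (R * R) := [set p | exists2 e, (e < 3)%N & Strip e p].

Definition Comb : set (R * R) := Rim `|` [set p | exists2 t, tidx t & Tooth t p].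

Definition Net : set (R * R) := Rim `|` [set p | exists2 l, idx l & Line l (1/10) p].

Lemma Line_open l r : open (Line l r).
Proof.
rewrite (_ : Line l r = \bigcup_(z in isarm l) Arm z r) //.
by apply: bigcup_open => z _; exact: polygon_open.
Qed.

Lemma Rim_open : open Rim.
Proof.
rewrite (_ : Rim = \bigcup_(e in [set e | (e < 3)%N]) Strip e) //.
by apply: bigcup_open => e _; exact: polygon_open.
Qed.

Lemma Comb_open : open Comb.
Proof.
apply: openU; first exact: Rim_open.
rewrite (_ : [set _ | _] = \bigcup_(t in tidx) Tooth t) //.
by apply: bigcup_open => t _; exact: polygon_open.
Qed.

Lemma Net_open : open Net.
Proof.
apply: openU; first exact: Rim_open.
rewrite (_ : [set _ | _] = \bigcup_(l in idx) Line l (1/10)) //.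
by apply: bigcup_open => l _; exact: Line_open.
Qed.

Lemma Line_mono l r r' : r <= r' -> Line l r `<=` Line l r'.
Proof. by move=> rr p [z zl zp]; exists z => //; exact: Arm_mono zp. Qed.

Lemma Arm_star z r p : Arm z r p -> star (Arm z r) p.
Proof. exact: polygon_star. Qed.

Lemma Strip_star e p : Strip e p -> star (Strip e) p.
Proof. exact: polygon_star. Qed.

Lemma Tooth_star t p : Tooth t p -> star (Tooth t) p.
Proof. exact: polygon_star. Qed.

Lemma Line_ctr l r e : idx l -> 0 <= e <= 4/25 -> e < r -> Line l r (ctr l e).
Proof.
move=> il he er.
have [z zl] : exists z, isarm l z.
  case: (region il) => -[h _ _ _ _]; rewrite /isarm.
  - by exists (1%N, l) => /=; move: h Q1; clear; lia.
  - by exists (1%N, l) => /=; move: h Q1; clear; lia.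
  - by exists (0%N, l) => /=; move: h Q1; clear; lia.
by exists z => //; exact: ctr_arm.
Qed.

Lemma Line_star l r e : idx l -> 0 <= e <= 4/25 -> e < r -> star (Line l r) (ctr l e).
Proof.
move=> il he er; apply: star_cover; first exact: Line_ctr.
move=> p [z zl zp]; exists (Arm z r); split=> //.
  by apply: Arm_star; exact: ctr_arm.
by move=> x zx; exists z.
Qed.

Lemma wall_lt l : (wall l < 3)%N.
Proof. by rewrite /wall; case: ifP => // _; case: ifP. Qed.

Lemma twall_lt t : (twall t < 3)%N.
Proof. by rewrite /twall; case: ifP => // _; case: ifP. Qed.

Lemma line_rim l r e : idx l -> 0 < e <= 4/25 -> e < r -> r <= 1/5 ->
  star (Line l r `&` Rim) (ctr l e).
Proof.
move=> il he er r5.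
have hw := ctr_strip il he.
have he' : 0 <= e <= 4/25 by case/andP: he => e0 ->; rewrite ltW.
apply: star_cover.
  by split; [exact: Line_ctr|exists (wall l); rewrite ?wall_lt].
move=> p [[z zl zp] [d d3 dp]].
have dw := arm_strip il zl (Arm_mono r5 zp) d3 dp; subst d.
exists (Arm z r `&` Strip (wall l)); split=> //.
  by apply: starI; [apply: Arm_star; exact: ctr_arm|exact: Strip_star].
by move=> x [zx dx]; split; [exists z|exists (wall l)].
Qed.

(** The strips form a chain, strip 2 meeting both others while strips 0 and 1 are disjoint. The
    opening is at the corner between walls 0 and 1, the one whose face has no tooth. *)
Lemma rim_contractible : contractible R Rim.
Proof.
have iQ : tidx Q by rewrite /tidx; move: Q1; clear; lia.
have iNQ : tidx (- Q) by rewrite /tidx; move: Q1; clear; lia.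
have [_] := tctr_tooth iQ; have [_] := tctr_tooth iNQ.
have tQ : twall Q = 0%N by rewrite /twall; move: Q1; clear; case: ifP; rewrite ?lexx //; lia.
have tNQ : twall (- Q) = 1%N by rewrite /twall; move: Q1; clear; case: ifP => //; lia.
rewrite tQ tNQ => h1 h0.
have h02 : Strip 2%N (tctr Q).
  have := tregion iQ; rewrite tQ => -[[]|[_ _ _ -> _]|[]] //.
  by have := q1; rewrite /Strip /= -/q; lra.
have h12 : Strip 2%N (tctr (- Q)).
  have := tregion iNQ; rewrite tNQ => -[[_ _ _ -> _]|[]|[]] //.
  by have := q1; rewrite /Strip /= rmorphN /= -/q; lra.
rewrite (_ : Rim = (Strip 0%N `|` Strip 2%N) `|` Strip 1%N); last first.
  apply/seteqP; split=> [p [[|[|[|e]]] // _ hp]|p [[hp|hp]|hp]].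
  - by left; left.
  - by right.
  - by left; right.
  - by exists 0%N.
  - by exists 2%N.
  - by exists 1%N.
apply: (@contractible_glue _ _ _ _ (tctr (- Q))).
- by apply: openU; exact: polygon_open.
- exact: polygon_open.
- by apply: (@star_contractible _ _ _ (tctr Q)); apply: starU; exact: Strip_star.
- exact: Strip_star.
rewrite (_ : _ `&` _ = Strip 2%N `&` Strip 1%N).
  by apply: starI; exact: Strip_star.
apply/seteqP; split=> [p [[h h'|h h']]|p [h h']]; last by split=> //; right.
  by exfalso; move: h h'; rewrite /Strip /= -/q; lra.
by split.
Qed.

Lemma comb_contractible : contractible R Comb.
Proof.
have [s hs] := int_range (- Q) (Q + Q).
rewrite (_ : Comb = Rim `|` [set p | exists2 t, t \in [seq t <- s | t != 0] & Tooth t p]);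
  last first.
  by congr (_ `|` _); apply/seteqP; split=> p [t it tp]; exists t => //; move: it;
    rewrite mem_filter hs andbC.
apply: (@contractible_attach _ _ _ _ _ _ tctr).
- exact: Rim_open.
- exact: rim_contractible.
- move=> t; rewrite mem_filter hs andbC => it; split; first exact: polygon_open.
    by apply: Tooth_star; have [] := tctr_tooth it.
  have [ht hw] := tctr_tooth it; apply: star_cover.
    by split=> //; exists (twall t); rewrite ?twall_lt.
  move=> p [[e e3 ep] tp]; exists (Strip e `&` Tooth t); split=> //.
    by apply: starI; [apply: Strip_star; exact: tooth_strip tp ep|exact: Tooth_star].
  by move=> x [ex tx]; split=> //; exists e.
- move=> t t'; rewrite !mem_filter !hs ![_ && (_ <= _ <= _)]andbC => it it' tt p [tp tp'].
  exact: tooth_tooth tp tp'.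
Qed.

Definition cross (l l' : int) : R * R :=
  let z := pick_pair (Num.min l l') (Num.max l l') in vtx z.1 z.2.

Lemma pair_arms l l' : idx l -> idx l' -> l != l' -> exists z z',
  [/\ isarm l z, isarm l' z',
    forall r, 0 < r -> Arm z r (cross l l') /\ Arm z' r (cross l l') &
    forall y y' p, isarm l y -> isarm l' y' ->
      Arm y (1/5) p -> Arm y' (1/5) p -> y = z /\ y' = z'].
Proof.
move=> il il' ne.
wlog ll' : l l' il il' ne / l < l'.
  move=> wl; have [h|h] : l < l' \/ l' < l by move: ne; clear; lia.
    exact: wl.
  have [|z [z' [zl zl' hr hu]]] := wl l' l il' il _ h; first by rewrite eq_sym.
  exists z', z; split=> //.
    by move=> r /hr[]; rewrite /cross minC maxC.
  by move=> y y' p yl yl' yp yp'; have [] := hu _ _ _ yl' yl yp' yp.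
have [zl zl' zz zm] := pick_pairP il il' ll'.
exists (pick_pair l l').1, (pick_pair l l').2; split=> //.
  move=> r r0; rewrite /cross (min_idPl (ltW ll')) (max_idPr (ltW ll')).
  by apply: vtxP => //; [exact: isarm_dir zl|exact: isarm_dir zl'].
move=> y y' p yl yl' yp yp'.
have := arms_meetP (isarm_dir yl) (isarm_dir yl') yp yp'.
by move=> /(pick_pair_unique il il' ll' yl yl') <-.
Qed.

Let r10 : 1/10 <= 1/5 :> R. Proof. by lra. Qed.

Lemma pair_star l l' r r' : idx l -> idx l' -> l != l' ->
  0 < r <= 1/5 -> 0 < r' <= 1/5 -> star (Line l r `&` Line l' r') (cross l l').
Proof.
move=> il il' ne /andP[r0 r5] /andP[r0' r5'].
have [z [z' [zl zl' hr hu]]] := pair_arms il il' ne.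
have [h _] := hr r r0; have [_ h'] := hr r' r0'.
apply: star_cover; first by split; [exists z|exists z'].
move=> p [[y yl yp] [y' yl' yp']].
have [e e'] := hu _ _ _ yl yl' (Arm_mono r5 yp) (Arm_mono r5' yp'); subst y y'.
exists (Arm z r `&` Arm z' r'); split=> //; first by apply: starI; exact: Arm_star.
by move=> x [xz xz']; split; [exists z|exists z'].
Qed.

Lemma pair_rim l l' p : idx l -> idx l' -> l != l' ->
  Line l (1/5) p -> Line l' (1/5) p -> ~ Rim p.
Proof.
move=> il il' ne [z zl zp] [z' zl' zp'] [e _ ep].
exact: (strip_inner ep (pair_inner il il' ne zl zl' zp zp')).
Qed.

Lemma triple_thin l l' l'' p : idx l -> idx l' -> idx l'' ->
  l != l' -> l != l'' -> l' != l'' ->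
  Line l (1/10) p -> Line l' (1/5) p -> Line l'' (1/5) p -> False.
Proof.
move=> il il' il'' n1 n2 n3 [z zl zp] [z' zl' zp'] [z'' zl'' zp''].
have [i [j [k [h1 h2 h3 _]]]] := three_arms il il' il'' n1 n2 n3 zl zl' zl''
  (Arm_mono r10 zp) zp' zp''.
case: z zl zp => [e l0] zl zp.
exact: (Arm_sum_thin h1 h2 h3 zp (isarm_dir zl)).
Qed.

Lemma pair_net_star l l' : idx l -> idx l' -> l != l' ->
  star (Line l (1/5) `&` Line l' (1/5) `&` Net) (cross l l').
Proof.
move=> il il' ne; have w1 : 0 < (1/10 : R) <= 1/5 by lra.
have w2 : 0 < (1/5 : R) <= 1/5 by lra.
have s1 := pair_star il il' ne w1 w2; have s2 := pair_star il il' ne w2 w1.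
apply: star_cover.
  case: s1 => -[h h'] _; split; first by split => //; exact: Line_mono h.
  by right; exists l.
move=> p [[pl pl'] [/(pair_rim il il' ne pl pl')//|[l'' il'' pl'']]].
have [e|n1] := eqVneq l'' l.
  subst l''; exists (Line l (1/10) `&` Line l' (1/5)); split=> // x [xl xl'].
  by split; [split=> //; exact: Line_mono xl|right; exists l].
have [e|n2] := eqVneq l'' l'.
  subst l''; exists (Line l (1/5) `&` Line l' (1/10)); split=> // x [xl xl'].
  by split; [split=> //; exact: Line_mono xl'|right; exists l'].
by case: (triple_thin il'' il il' n1 n2 ne pl'' pl pl').
Qed.

(** The thin line serves as a core, to which are attached the part in the rim ([None]) and the
    crossings with the other thin lines ([Some l']). These pieces are pairwise disjoint, because no
    two lines meet on the rim and no point lies on three lines one of which is thin. *)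
Lemma line_net_contractible l : idx l -> contractible R (Line l (1/5) `&` Net).
Proof.
move=> il; have [s hs] := int_range (1 - Q) (Q + Q + 1).
have w1 : 0 < (1/10 : R) <= 1/5 by lra.
have w2 : 0 < (1/5 : R) <= 1/5 by lra.
have we : 0 < (1/50 : R) <= 4/25 by lra.
have we' : 0 <= (1/50 : R) <= 4/25 by lra.
have we1 : 1/50 < 1/10 :> R by lra.
have we2 : 1/50 < 1/5 :> R by lra.
pose P (i : option int) : set (R * R) :=
  if i is Some l' then Line l (1/5) `&` Line l' (1/10) else Line l (1/5) `&` Rim.
pose c (i : option int) : R * R := if i is Some l' then cross l l' else ctr l (1/50).
pose ix : seq (option int) := None :: [seq Some l' | l' <- s & l' != l].
have ixP (l' : int) : Some l' \in ix -> idx l' /\ l != l'.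
  rewrite inE /= => /mapP[u]; rewrite mem_filter hs => /andP[ul iu] [->].
  by rewrite eq_sym.
rewrite (_ : _ `&` _ = Line l (1/10) `|` [set p | exists2 i, i \in ix & P i p]); last first.
  apply/seteqP; split=> [p [pl [pr|[l' il' pl']]]|p [pl|[[l'|] li Pp]]].
  - by right; exists None.
  - have [e|n] := eqVneq l' l; first by subst l'; left.
    right; exists (Some l') => //; rewrite inE /=; apply/mapP; exists l' => //.
    by rewrite mem_filter n hs.
  - by split; [exact: Line_mono pl|right; exists l].
  - by have [il' _] := ixP _ li; case: Pp => pl pl'; split=> //; right; exists l'.
  - by case: Pp => pl pr; split=> //; left.
apply: (@contractible_attach _ _ _ _ _ _ c).
- exact: Line_open.
- by apply: star_contractible; exact: (@Line_star l (1/10) (1/50)).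
- move=> [l' /ixP[il' ne]|_]; rewrite /P /c.
    split; first by apply: openI; exact: Line_open.
      exact: pair_star.
    rewrite (_ : _ `&` (_ `&` _) = Line l (1/10) `&` Line l' (1/10)); first exact: pair_star.
    apply/seteqP; split=> p; first by move=> [h [_ h']].
    by move=> [h h']; do 2!split=> //; exact: Line_mono h.
  split; first by apply: openI; [exact: Line_open|exact: Rim_open].
    exact: line_rim.
  rewrite (_ : _ `&` (_ `&` _) = Line l (1/10) `&` Rim); first exact: line_rim.
  apply/seteqP; split=> p; first by move=> [h [_ h']].
  by move=> [h h']; do 2!split=> //; exact: Line_mono h.
- move=> [l1|] [l2|] // h1 h2 n12 p; rewrite /P.
  + have [i1 n1] := ixP _ h1; have [i2 n2] := ixP _ h2.
    have n3 : l1 != l2 by apply/eqP => e; move: n12; rewrite e eqxx.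
    rewrite eq_sym in n1; move=> [[pl p1] [_ p2]].
    by case: (triple_thin i1 il i2 n1 n3 n2 p1 pl (Line_mono r10 p2)).
  + have [i1 n1] := ixP _ h1; move=> [[pl p1] [_ pr]].
    by case: (pair_rim il i1 n1 pl (Line_mono r10 p1)).
  + have [i2 n2] := ixP _ h2; move=> [[pl pr] [_ p2]].
    by case: (pair_rim il i2 n2 pl (Line_mono r10 p2)).
Qed.

(** This makes the comb and the net meet in a contractible set, and keeps two lines, the comb and
    the net from having a common point, as two lines never meet on the rim. *)
Lemma comb_net : Comb `&` Net = Rim.
Proof.
apply/seteqP; split=> [p [[//|[t it tp]] [//|[l il [z zl zp]]]]|p pr]; last by split; left.
by exists (twall t); [exact: twall_lt|exact: (thin_tooth il zl it zp tp)].
Qed.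

Lemma line_comb_net_star l : idx l ->
  star (Line l (1/5) `&` Comb `&` Net) (ctr l (1/50)).
Proof. by move=> il; rewrite -setIA comb_net; apply: line_rim => //; lra. Qed.

Lemma triple_star l l' l'' p : idx l -> idx l' -> idx l'' ->
  l != l' -> l != l'' ->
  (Line l (1/5) `&` Line l' (1/5) `&` Line l'' (1/5)) p ->
  star (Line l (1/5) `&` Line l' (1/5) `&` Line l'' (1/5)) p.
Proof.
move=> il il' il'' n1 n2 pp.
have [z [z' [zl zl' _ hu]]] := pair_arms il il' n1.
have [y [y'' [yl yl'' _ hu'']]] := pair_arms il il'' n2.
have all_arms x : (Line l (1/5) `&` Line l' (1/5) `&` Line l'' (1/5)) x ->
    [/\ Arm z (1/5) x, Arm z' (1/5) x & Arm y'' (1/5) x].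
  move=> [[[u ul ux] [u' ul' ux']] [u'' ul'' ux'']].
  have [? ?] := hu _ _ _ ul ul' ux ux'; have [? ?] := hu'' _ _ _ ul ul'' ux ux''.
  by subst u u' u''.
apply: star_cover => // x /all_arms[x1 x2 x3]; have [p1 p2 p3] := all_arms _ pp.
exists (Arm z (1/5) `&` Arm z' (1/5) `&` Arm y'' (1/5)); split=> //.
  by apply: starI; [apply: starI|]; exact: Arm_star.
by move=> v [[v1 v2] v3]; split; [split|]; [exists z|exists z'|exists y''].
Qed.

Lemma pair_comb l l' p : idx l -> idx l' -> l < l' ->
  (Line l (1/5) `&` Line l' (1/5) `&` Comb) p ->
  exists t, [/\ tidx t, l = lo t, l' = hi t & Tooth t p].
Proof.
move=> il il' ll' [[pl pl'] [pr|[t it tp]]].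
  by case: (pair_rim il il' _ pl pl' pr); rewrite lt_eqF.
case: pl pl' => [z zl zp] [z' zl' zp'].
by have [-> ->] := pair_tooth il il' ll' zl zl' it zp zp' tp; exists t.
Qed.

Lemma lo_inj t t' : tidx t -> tidx t' -> lo t = lo t' -> hi t = hi t' -> t = t'.
Proof.
move: Q1; rewrite /tidx /lo /hi; clear => Q1 it it'.
by case: eqP => h; case: eqP => h'; lia.
Qed.

Lemma pair_comb_star l l' p : idx l -> idx l' -> l < l' ->
  (Line l (1/5) `&` Line l' (1/5) `&` Comb) p ->
  star (Line l (1/5) `&` Line l' (1/5) `&` Comb) p.
Proof.
move=> il il' ll' pp; have [t [it lt ht tp]] := pair_comb il il' ll' pp.
have ne : l != l' by rewrite lt_eqF.
have [z [z' [zl zl' _ hu]]] := pair_arms il il' ne.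
have arms x : Line l (1/5) x -> Line l' (1/5) x -> Arm z (1/5) x /\ Arm z' (1/5) x.
  move=> [u ul ux] [u' ul' ux'].
  by have [? ?] := hu _ _ _ ul ul' ux ux'; subst u u'.
apply: star_cover => // x px; have [t' [it' lt' ht' tx]] := pair_comb il il' ll' px.
have e : t' = t by apply: lo_inj; rewrite -?lt -?ht.
subst t'; case: px => -[xl xl'] _; have [x1 x2] := arms _ xl xl'.
case: pp => -[pl pl'] _; have [p1 p2] := arms _ pl pl'.
exists (Arm z (1/5) `&` Arm z' (1/5) `&` Tooth t); split=> //.
  by apply: starI; [apply: starI; exact: Arm_star|exact: Tooth_star].
move=> v [[v1 v2] v3]; split; first by split; [exists z|exists z'].
by right; exists t.
Qed.

Lemma triple_comb l l' l'' p : idx l -> idx l' -> idx l'' -> l < l' -> l' < l'' ->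
  Line l (1/5) p -> Line l' (1/5) p -> Line l'' (1/5) p -> ~ Comb p.
Proof.
move=> il il' il'' ll' ll'' pl pl' pl'' px.
have [t [it e1 e2 tp]] := pair_comb il il' ll' (conj (conj pl pl') px).
have [t' [it' e1' e2' _]] := pair_comb il' il'' ll'' (conj (conj pl' pl'') px).
have [t'' [it'' e1'' e2'' _]] := pair_comb il il'' (lt_trans ll' ll'') (conj (conj pl pl'') px).
move: e1 e2 e1' e2' e1'' e2'' it it' it'' Q1 ll' ll''; rewrite /lo /hi /tidx; clear.
by do 3!(case: eqP => ?); lia.
Qed.

(** The tooth [t0] left out is the one that the line may meet away from its own wall, and which
    spoils star-shapedness. *)
Definition line_comb_but l (t0 : int) : set (R * R) :=
  Line l (1/5) `&` (Rim `|` [set p | exists2 t, tidx t && (t != t0) & Tooth t p]).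

(** As [3/20 < 4/25 < 1/5], the foot of the line pushed across its wall by [4/25] is still in the
    line and already in the adjacent teeth of that wall, so it is a common centre of all the
    pieces. *)
Lemma line_comb_but_star l t0 : idx l ->
  (forall z t p, isarm l z -> tidx t -> t != t0 -> Arm z (1/5) p -> Tooth t p ->
     Tooth t (ctr l (4/25))) ->
  star (line_comb_but l t0) (ctr l (4/25)).
Proof.
move=> il ht; have he : 0 < (4/25 : R) <= 4/25 by lra.
have he' : 0 <= (4/25 : R) <= 4/25 by lra.
have e5 : 4/25 < 1/5 :> R by lra.
have [[_ crim] _] := line_rim il he e5 (lexx _).
apply: star_cover.
  by split; [exact: Line_ctr|left].
move=> p [[z zl zp] [[e e3 ep]|[t /andP[it tt] tp]]].
  have ew := arm_strip il zl zp e3 ep; subst e.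
  exists (Arm z (1/5) `&` Strip (wall l)); split=> //.
    by apply: starI; [apply: Arm_star; exact: ctr_arm|apply: Strip_star; exact: ctr_strip].
  by move=> x [zx dx]; split; [exists z|left; exists (wall l)].
exists (Arm z (1/5) `&` Tooth t); split=> //.
  by apply: starI; [apply: Arm_star; exact: ctr_arm|apply: Tooth_star; exact: (ht z t p)].
by move=> x [zx dx]; split; [exists z|right; exists t => //; apply/andP].
Qed.

(* When a line meets a tooth of a wall other than its own, that part is linked to
   the rest of the intersection through the strip of its own wall only. *)
Lemma line_comb_glue l t0 z0 c0 : idx l -> wall l = 2%N -> tidx t0 -> isarm l z0 ->
  (forall z t p, isarm l z -> tidx t -> t != t0 -> Arm z (1/5) p -> Tooth t p ->
     Tooth t (ctr l (4/25))) ->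
  (forall z p, isarm l z -> Arm z (1/5) p -> Tooth t0 p -> z = z0) ->
  Arm z0 (1/5) c0 -> Tooth t0 c0 -> Strip 2%N c0 ->
  contractible R (Line l (1/5) `&` Comb).
Proof.
move=> il wl it zl0 ht hz0 zc0 tc0 sc0.
have -> : Line l (1/5) `&` Comb = line_comb_but l t0 `|` (Arm z0 (1/5) `&` Tooth t0).
  apply/seteqP; split=> [p [pl [pr|[t tt tp]]]|p [[pl [pr|[t /andP[tt _] tp]]]|[zp tp]]].
  - by left; split=> //; left.
  - have [e|e] := eqVneq t t0; last first.
      by left; split=> //; right; exists t => //; apply/andP.
    subst t; case: pl => z zl zp; right; split=> //.
    by rewrite -(hz0 z p).
  - by split=> //; left.
  - by split=> //; right; exists t.
  - by split; [exists z0|right; exists t0].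
apply: (@contractible_glue _ _ _ _ c0).
- apply: openI; first exact: Line_open.
  apply: openU; first exact: Rim_open.
  rewrite (_ : [set _ | _] = \bigcup_(t in [set t | tidx t && (t != t0)]) Tooth t) //.
  by apply: bigcup_open => t _; exact: polygon_open.
- by apply: openI; exact: polygon_open.
- by apply: star_contractible; exact: line_comb_but_star.
- by apply: starI; [exact: Arm_star|exact: Tooth_star].
rewrite (_ : line_comb_but l t0 `&` _ = Arm z0 (1/5) `&` Tooth t0 `&` Strip 2%N).
  by apply: starI; [apply: starI; [exact: Arm_star|exact: Tooth_star]|exact: Strip_star].
have strip2 e p : Arm z0 (1/5) p -> (e < 3)%N -> Strip e p -> Strip 2%N p.
  by move=> zp e3 ep; rewrite -wl -(arm_strip il zl0 zp e3 ep).
apply/seteqP; split=> [p [[pl hp] [zp tp]]|p [[zp tp] sp]].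
  split=> //; case: hp => [[e e3 ep]|[t /andP[tt tt0] tp']]; first exact: strip2 ep.
  by have [e e3 ep] := tooth_tooth tt it tt0 tp' tp; exact: strip2 ep.
by split=> //; split; [exists z0|left; exists 2%N].
Qed.

(** Only the two extreme lines of wall 2, [Q + 1] and [Q + Q + 1], reach a tooth of another wall;
    they need gluing, all the other lines give a star-shaped set. *)
Lemma line_comb_contractible l : idx l -> contractible R (Line l (1/5) `&` Comb).
Proof.
move=> il.
have regular z t p : isarm l z -> tidx t -> Arm z (1/5) p -> Tooth t p ->
  [\/ Tooth t (ctr l (4/25)), t = Q /\ l = Q + 1 | t = - Q /\ l = Q + Q + 1].
  move=> zl it zp tp; case: (arm_tooth il zl it zp tp) => [[_ _ h]|[-> -> _]|[-> -> _]].
  - exact: Or31.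
  - exact: Or32.
  - exact: Or33.
have iQ : tidx Q by rewrite /tidx; move: Q1; clear; lia.
have iNQ : tidx (- Q) by rewrite /tidx; move: Q1; clear; lia.
have [e1|n1] := eqVneq l (Q + 1); last have [e2|n2] := eqVneq l (Q + Q + 1).
(* The first coordinate lies between [q + 4/5], where the arm begins, and [q + 17/20], where the
   tooth ends; the second one puts the point just across wall 2. *)
- apply: (@line_comb_glue l Q (0%N, l) (q + 41/50, q + 22/25)) => //.
  + by rewrite e1 /wall; move: Q1; clear; case: ifP; [lia|case: ifP => //; lia].
  + by rewrite e1 /isarm /=; move: Q1; clear; lia.
  + move=> z t p zl it tQ zp tp; case: (regular z t p zl it zp tp) => [//|[e _]|[_ e]].
      by rewrite e eqxx in tQ.
    by move: e e1 Q1; clear; lia.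
  + move=> z p zl zp tp.
    case: (arm_tooth il zl iQ zp tp) => [[_ e _]|[_ _ ->]//|[_ e _]].
      by move: e; rewrite e1 /wall /twall; move: Q1; clear; do ?case: ifP; rewrite ?lexx //; lia.
    by move: e e1 Q1; clear; lia.
  + by have := q1; rewrite e1 /Arm /= rmorphD /= -/q; lra.
  + case: (tregion iQ) => -[bt _ _ _ eT]; rewrite eT; clear eT.
    * by move: bt Q1; clear; lia.
    * by have := q1; rewrite /= -/q; lra.
    * by move: bt Q1; clear; lia.
  + by have := q1; rewrite /Strip /= -/q; lra.
- apply: (@line_comb_glue l (- Q) (2%N, - Q) (2 * q + 6/5, 3/25 - q)) => //.
  + by rewrite e2 /wall; move: Q1; clear; case: ifP; [lia|case: ifP => //; lia].
  + by rewrite e2 /isarm /=; move: Q1; clear; lia.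
  + move=> z t p zl it tQ zp tp; case: (regular z t p zl it zp tp) => [//|[_ e]|[e _]].
      by move: e e2 Q1; clear; lia.
    by rewrite e eqxx in tQ.
  + move=> z p zl zp tp.
    case: (arm_tooth il zl iNQ zp tp) => [[_ e _]|[e _ _]|[_ _ ->]//].
      by move: e; rewrite e2 /wall /twall; move: Q1; clear; do ?case: ifP => //; lia.
    by move: e Q1; clear; lia.
  + by have := q1; rewrite /Arm /= rmorphN /= -/q; lra.
  + case: (tregion iNQ) => -[bt _ _ _ eT]; rewrite eT; clear eT.
    * by have := q1; rewrite /= rmorphN -/q; lra.
    * by move: bt Q1; clear; lia.
    * by move: bt Q1; clear; lia.
  + by have := q1; rewrite /Strip /= -/q; lra.
(* The value 0 is not the index of a tooth, so nothing is left out. *)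
rewrite (_ : _ `&` _ = line_comb_but l 0).
  apply: star_contractible; apply: line_comb_but_star => // z t p zl it _ zp tp.
  case: (regular z t p zl it zp tp) => [//|[_ e]|[_ e]].
    by rewrite e eqxx in n1.
  by rewrite e eqxx in n2.
apply/seteqP; split=> p [pl [pr|[t it tp]]]; split=> //; try by left.
  by right; exists t => //; rewrite it; case/andP: it.
by right; exists t => //; case/andP: it.
Qed.

Lemma rim_net : Rim `<=` Net. Proof. by move=> p; left. Qed.

Lemma line_net l : idx l -> Line l (1/10) `<=` Net.
Proof. by move=> il p lp; right; exists l. Qed.

Lemma net_path_connected : path_connected R Net.
Proof.
pose P (i : option int) : set (R * R) :=
  if i is Some l then [set p | idx l /\ Line l (1/10) p] else Rim.
have i1 : idx 1 by rewrite /idx; move: Q1; clear; lia.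
have he : 0 < (1/50 : R) <= 4/25 by lra.
have he' : 0 <= (1/50 : R) <= 4/25 by lra.
have e5 : 1/50 < 1/10 :> R by lra.
have r5 : 1/10 <= 1/5 :> R by lra.
have foot l : idx l -> (Line l (1/10) `&` Rim) (ctr l (1/50)).
  by move=> il; have [] := line_rim il he e5 r5.
have NP : Net = \bigcup_i P i.
  apply/seteqP; split=> [p [pr|[l il pl]]|p [[l|] _ //]].
  - by exists None.
  - by exists (Some l).
  - by case=> il pl; right; exists l.
  - by left.
have rim x y : Rim x -> Rim y -> @joined R _ Net x y.
  move=> rx ry; apply: (@joined_sub R _ _ _ _ _ rim_net).
  have pc := contractible_path_connected rim_contractible.
  exact (pc x y rx ry).
rewrite NP; apply: (@path_connected_bigcup R _ _ _ (ctr 1 (1/50))) => i x; rewrite -NP.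
case: i => [l [il lx]|rx]; last by apply: rim => //; case: (foot 1 i1).
apply: (@joined_trans R _ _ _ (ctr l (1/50))); last first.
  by apply: rim; [case: (foot l il)|case: (foot 1 i1)].
apply: (@joined_sub R _ _ _ _ _ (line_net il)).
have pc := contractible_path_connected (star_contractible (Line_star il he' e5)).
exact (pc x (ctr l (1/50)) lx (foot l il).1).
Qed.

(** The thick lines through the coordinates 2, 1 and -1 have a common point, as [2 + 1 - 1 = 2];
    thinning turns it into the hole. In the hole every coordinate is at distance at least [1/10]
    from all integers, so no thin line enters it. *)
Lemma net_not_contractible : ~ contractible R Net.
Proof.
have hq := q1.
apply: hole_not_contractible => [s s03|p].
  have [h|h] := lerP s 1; last have [h'|h'] := lerP s 2.
  - rewrite tri_loop1; last by lra.
    right; exists 2; first by rewrite /idx; move: Q1; clear; lia.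
    exists (0%N, 2); first by [].
    by rewrite /Arm /= -/q; lra.
  - rewrite tri_loop2; last by lra.
    have [l [il al]] : exists l, idx l /\ isarm l (2%N, -1).
      have [e|n] := eqVneq Q 1; first by exists 3; rewrite /idx /isarm /= e.
      by exists (-1); rewrite /idx /isarm /=; move: n Q1; clear; lia.
    right; exists l => //; exists (2%N, -1) => //.
    by rewrite /Arm /= -/q; lra.
  - rewrite tri_loop3; last by lra.
    right; exists 1; first by rewrite /idx; move: Q1; clear; lia.
    exists (1%N, 1); first by rewrite /isarm /=; move: Q1; clear; lia.
    by rewrite /Arm /= -/q; lra.
move=> np; have [h|h1] := ltrP (2 - 1/10) p.1; first by left.
have [h|h2] := ltrP (1 - 1/10) p.2; first by right; left.
have [h|h3] := ltrP (p.1 + p.2) (5/2 + 1/10); first by right; right.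
exfalso; case: np => [[[|[|[|e]]] // _]|[l il [[[|[|[|e]]] k] // _]]];
  rewrite /Strip /Arm /= -/q => hp.
- lra.
- lra.
- lra.
- suff [a1 a2] : 1 <= k - 1 /\ 1 <= 1 + 1 - k by move: a1 a2; clear; lia.
  by split; apply: pos_int; rewrite !(rmorphB, rmorphD) /=; lra.
- suff [a1 a2] : 1 <= k /\ 1 <= 1 - k by move: a1 a2; clear; lia.
  by split; apply: pos_int; rewrite ?(rmorphB, rmorphD) /=; lra.
- suff [a1 a2] : 1 <= k + 1 + 1 /\ 1 <= - 1 - k by move: a1 a2; clear; lia.
  by split; apply: pos_int; rewrite ?(rmorphB, rmorphD, rmorphN) /=; lra.
Qed.

End Configuration.

(** * Counting triples *)

Section Sums.
Variables (G : finZmodType) (c : G).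

Definition sum3 : {set {set G}} :=
  [set s : {set G} | (#|s| == 3)%N && (\sum_(x in s) x == c)]%SET.

Let good (x y : G) := (c - x - y != x) && (c - x - y != y).

Lemma card_set3 (T : finType) (x y z : T) : x != y -> x != z -> y != z -> #|[set x; y; z]%SET| = 3.
Proof.
by move=> xy xz yz; rewrite finset.setUC cardsU1 cards2 !inE negb_or eq_sym xz eq_sym yz xy.
Qed.

Lemma sum_set3 (x y z : G) : x != y -> x != z -> y != z ->
  \sum_(u in [set x; y; z]%SET) u = x + y + z.
Proof.
move=> xy xz yz; rewrite finset.setUC big_setU1 /=; last by rewrite !inE negb_or eq_sym xz eq_sym.
by rewrite big_setU1 ?inE //= big_set1 addrC.
Qed.

Let complete (x y : G) : x != y ->
  \sum_(s in sum3 | (x \in s) && (y \in s)) 1 = good x y :> nat.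
Proof.
move=> xy; rewrite sum1dep_card.
have sumE : x + y + (c - x - y) = c by rewrite -addrA [y + _]addrC subrK addrC subrK.
have only s : s \in sum3 -> x \in s -> y \in s -> good x y /\ s = [set x; y; c - x - y]%SET.
  rewrite inE => /andP[/eqP s3 /eqP sc] xs ys.
  have : #|s :\ x :\ y| == 1.
    have ysx : y \in s :\ x by rewrite !inE eq_sym xy ys.
    by apply/eqP; move: s3; rewrite (cardsD1 x) xs (cardsD1 y) ysx; lia.
  move=> /cards1P[z sz].
  have : z \in s :\ x :\ y by rewrite sz set11.
  rewrite !inE => /and3P[zy zx zs].
  have se : s = [set x; y; z]%SET.
    apply/setP => u; have := congr1 (fun A : {set G} => u \in A) sz; rewrite !inE.
    by have [->|_] := eqVneq u x; last have [->|_] := eqVneq u y; rewrite ?xs ?ys.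
  have zE : z = c - x - y.
    by rewrite -sc se sum_set3 ?[_ == z]eq_sym // -[RHS]addrA -opprD [x + y + z]addrC addrK.
  by rewrite /good -zE zx zy.
case: (boolP (good x y)) => [/andP[g1 g2]|g] /=.
  apply/eqP/cards1P; exists [set x; y; c - x - y]%SET; apply/setP => s; rewrite [in RHS]inE inE.
  apply/idP/eqP => [/andP[s3 /andP[xs ys]]|->]; first by have [] := only s s3 xs ys.
  by rewrite !inE !eqxx orbT card_set3 ?sum_set3 // 1?eq_sym // ?sumE ?eqxx.
apply: eq_card0 => s; rewrite inE; apply/negP => /andP[s3 /andP[xs ys]].
by have [gd] := only s s3 xs ys; rewrite gd in g.
Qed.

Let degree (x : G) : (#|[set s in sum3 | x \in s]%SET| * 2 = \sum_(y | y != x) good x y)%N.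
Proof.
transitivity (\sum_(s in sum3 | x \in s) \sum_(y | (y != x) && (y \in s)) 1)%N.
  rewrite -sum1dep_card big_distrl /=; apply: eq_bigr => s /andP[]; rewrite inE.
  move=> /andP[/eqP s3 _] xs; rewrite mul1n sum1dep_card.
  rewrite (_ : 2 = #|s :\ x|)%N; last by move: s3; rewrite (cardsD1 x) xs; lia.
  apply: eq_card => y.
  by rewrite !inE.
rewrite (exchange_big_dep (fun y => y != x)) /=; last by move=> s y _ /andP[].
apply: eq_bigr => y yx; rewrite -complete; last by rewrite eq_sym.
apply: eq_bigl => s.
by rewrite yx -andbA.
Qed.

(** A triple through [x] is counted once for each of its two other elements. With two target sums, a
    line lies in at most [3 q] triples, the price of deleting it. *)
Lemma sum3_degree (x : G) : (#|[set s in sum3 | x \in s]%SET| * 2 <= #|G|.-1)%N.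
Proof.
rewrite degree -(cardC1 x) -sum1_card.
by apply: leq_sum => y _; case: (good x y).
Qed.

(** Let [N] be the order of the group. Among the [N * (N - 1)] ordered pairs of distinct [x], [y],
    the completion [c - x - y] equals [x] in [N - 1] cases, one for each [x] except the root of
    [x *+ 3 = c]; likewise for [y]. The other [(N - 1) * (N - 2)] pairs count each triple six
    times. *)
Lemma card_sum3 : (exists o : G, forall x, (x *+ 3 == c) = (x == o)) ->
  (#|sum3| * 6 = #|G|.-1 * (#|G|.-1).-1)%N.
Proof.
case=> o ho.
have -> : (#|sum3| * 6 = \sum_x \sum_(y | y != x) good x y)%N.
  under [RHS]eq_bigr do rewrite -degree -sum1dep_card.
  rewrite -big_distrl /= (exchange_big_dep (mem sum3)) /=; last by move=> x s _ /andP[].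
  rewrite -sum1_card !big_distrl /=; apply: eq_bigr => s s3.
  rewrite (eq_bigl (mem s)); last by move=> x; rewrite s3.
  by move: s3; rewrite inE sum1_card => /andP[/eqP -> _].
have G0 : (0 < #|G|)%N by apply/card_gt0P; exists o.
have d : (\sum_x \sum_(y | y != x) (c - x - y == x)%R = #|G|.-1)%N.
  rewrite -(cardC1 o) -sum1_card big_mkcond /= [RHS]big_mkcond /=; apply: eq_bigr => x _.
  have e (y : G) : (c - x - y == x) = (y == c - x - x).
    by rewrite subr_eq [x + y]addrC -subr_eq eq_sym.
  rewrite big_mkcond /= (bigD1 (c - x - x)) //= big1 => [|y yx]; last first.
    by rewrite e (negPf yx); case: ifP.
  rewrite addn0 e eqxx.
  rewrite (_ : (c - x - x == x) = (x == o)) ?inE; first by case: eqP.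
  by rewrite -ho -addrA -opprD subr_eq eq_sym -mulr2n -mulrS.
have d' : (\sum_x \sum_(y | y != x) (c - x - y == y)%R = #|G|.-1)%N.
  rewrite -[RHS]d (exchange_big_dep xpredT) //=; apply: eq_bigr => x _.
  by apply: eq_big => y; rewrite 1?eq_sym //= => _; rewrite addrAC.
have t : (\sum_x \sum_(y : G | y != x) 1 = #|G| * #|G|.-1)%N.
  rewrite -sum_nat_const; apply: eq_bigr => x _.
  by rewrite sum1_card cardC1.
have : (\sum_x \sum_(y : G | y != x) 1 = \sum_x \sum_(y | y != x) good x y +
   \sum_x \sum_(y | y != x) (c - x - y == x)%R + \sum_x \sum_(y | y != x) (c - x - y == y)%R)%N.
  rewrite -!big_split /=; apply: eq_bigr => x _; rewrite -!big_split /=; apply: eq_bigr => y yx.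
  rewrite /good; case: eqP => [->|_]; rewrite ?[x == y]eq_sym ?(negPf yx) //.
  by case: eqP.
rewrite t d d'; move: G0; case: #|G| => //= m _; case: m => [|m] /=; lia.
Qed.

End Sums.

(** * Nerves and passage to subfamilies *)

Section Nerve.
Context {T : Type}.

Definition inter (I : finType) (F : I -> set T) (s : {set I}) : set T :=
  \bigcap_(i in [set` s]) F i.

Definition somes (I : finType) (s : {set option I}) : {set I} := [set i | Some i \in s]%SET.

Lemma inter_option (I : finType) (F : option I -> set T) (s : {set option I}) :
  inter F s = (if None \in s then F None else setT) `&` inter (F \o Some) (somes s).
Proof.
apply/seteqP; split=> [p sp|p [np sp] [i|] /= si].
- split=> [|i /=]; first by case: ifP => // ns; exact: sp.
  by rewrite inE => si; exact: sp.
- by apply: (sp i); rewrite /= inE.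
- by move: np; rewrite si.
Qed.

Lemma card_somes (I : finType) (s : {set option I}) : #|s| = ((None \in s) + #|somes s|)%N.
Proof.
rewrite (cardsD1 None s); congr (_ + _)%N.
rewrite -(card_imset (mem (somes s)) Some_inj); apply: eq_card => -[i|].
  by rewrite (mem_imset _ _ Some_inj) !inE.
by rewrite !inE /=; symmetry; apply/imsetP => -[].
Qed.

(** The base set [Y] lets the net and then the comb be peeled off the index type, each being
    absorbed into the base. *)
Definition nerve (I : finType) (Y : set T) (F : I -> set T) (k : nat) (D : {set I}) :
    {set {set I}} :=
  [set s : {set I} | [&& s \subset D, #|s| == k & `[< Y `&` inter F s !=set0 >]]]%SET.

Lemma nerve_option (I : finType) Y (F : option I -> set T) k (D : {set option I}) :
  #|nerve Y F k.+1 D| =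
  (#|nerve Y (F \o Some) k.+1 (somes D)| +
   (None \in D) * #|nerve (Y `&` F None) (F \o Some) k (somes D)|)%N.
Proof.
pose withN := [set s : {set option I} | None \in s]%SET.
have sK (w : {set I}) : somes (Some @: w) = w.
  by apply/setP => i; rewrite inE (mem_imset _ _ Some_inj).
have sNK (w : {set I}) : somes (None |: Some @: w)%SET = w.
  by apply/setP => i; rewrite !inE /= (mem_imset _ _ Some_inj).
have nN (w : {set I}) : (None \in Some @: w) = false by apply/imsetP => -[].
have sE (s : {set option I}) :
    s = (if None \in s then None |: Some @: somes s else Some @: somes s)%SET.
  apply/setP => o; have [h|h] := boolP (None \in s); case: o => [i|];
    by rewrite /= ?in_setU1 ?h ?nN ?(mem_imset _ _ Some_inj) ?inE //= (negPf h).
have sub (s : {set option I}) :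
    (s \subset D) = ((None \in s) ==> (None \in D)) && (somes s \subset somes D).
  apply/idP/andP => [/fintype.subsetP h|[/implyP h /fintype.subsetP h']].
    by split; [apply/implyP; exact: h|apply/fintype.subsetP => i; rewrite !inE; exact: h].
  by apply/fintype.subsetP => -[i|] // si; have := h' i; rewrite !inE; exact.
rewrite -(cardsID withN) addnC; congr (_ + _)%N.
  rewrite -(card_in_imset (f := fun w : {set I} => Some @: w)); last first.
    by move=> w w' _ _ e; rewrite -(sK w) e sK.
  apply: eq_card => s; rewrite !inE; apply/andP/imsetP => [[ns]|[w]].
    rewrite sub card_somes inter_option (negPf ns) setTI => /= h.
    by exists (somes s); rewrite ?inE // {1}[s]sE (negPf ns).
  by rewrite inE => h ->; rewrite sub card_somes inter_option nN sK setTI.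
case: (boolP (None \in D)) => [ND|ND]; last first.
  apply: eq_card0 => s; rewrite !inE; apply/negP => /andP[/and3P[/fintype.subsetP h _ _] /h].
  exact/negP.
rewrite mul1n -(card_in_imset (f := fun w : {set I} => None |: Some @: w)%SET); last first.
  by move=> w w' _ _ e; rewrite -(sNK w) e sNK.
apply: eq_card => s; rewrite !inE; apply/andP/imsetP => [[]|[w]].
  rewrite sub card_somes inter_option => + ns; rewrite ns ND setIA => /= h.
  by exists (somes s); rewrite ?inE // {1}[s]sE ns.
by rewrite inE => h ->; rewrite sub card_somes inter_option sNK !inE ND setIA.
Qed.

Lemma nerve_all (I : finType) Y (F : I -> set T) k (D : {set I}) :
  (forall s : {set I}, #|s| = k -> Y `&` inter F s !=set0) ->
  #|nerve Y F k D| = 'C(#|D|, k).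
Proof.
move=> h; rewrite -cards_draws; apply: eq_card => s; rewrite !inE.
by congr (_ && _); case: eqP => //= /h /asboolT ->.
Qed.

Section Restriction.
Variables (I : finType) (F : I -> set T) (D : {set I}).

Definition family (i : 'I_#|D|) : set T := F (enum_val i).

Lemma meet_family (s : {set 'I_#|D|}) : meet family s = inter F (enum_val @: s).
Proof.
apply/seteqP; split=> p sp i /= si; last by apply: sp; exact: imset_f.
by case/imsetP: si => j sj ->; exact: sp.
Qed.

Lemma card_family (s : {set 'I_#|D|}) : #|[set enum_val i | i in s]%SET| = #|s|.
Proof. by apply: card_imset; exact: enum_val_inj. Qed.

Lemma fnum_family k : fnum family k = #|nerve setT F k.+1 D|.
Proof.
rewrite /fnum -(card_imset _ (imset_inj (@enum_val_inj _ (mem D)))).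
apply: eq_card => s; rewrite inE; apply/imsetP/and3P => [[w]|[sD s3 sn]].
  rewrite inE => /andP[w3 wn] ->; rewrite setTI -meet_family card_family; split=> //.
  by apply/fintype.subsetP => i /imsetP[j _ ->]; exact: enum_valP.
have e : s = (enum_val @: (enum_val @^-1: s : {set 'I_#|D|}))%SET.
  apply/setP => i; apply/idP/imsetP => [si|[j]]; last by rewrite inE => h ->.
  exists (enum_rank_in (fintype.subsetP sD i si) i); rewrite ?inE enum_rankK_in //;
    exact: (fintype.subsetP sD).
exists (enum_val @^-1: s)%SET => //.
by rewrite inE -card_family meet_family -e s3 /=; rewrite setTI in sn.
Qed.

End Restriction.
End Nerve.

Lemma sorted_enum n (w : {set 'I_n}) (s : seq 'I_n) : enum w = s -> sorted ltn (map val s).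
Proof.
move=> <-; have : sorted ltn (map val (enum 'I_n)) by rewrite val_enum_ord iota_ltn_sorted.
rewrite !sorted_map.
by apply: sorted_filter => x y z; exact: ltn_trans.
Qed.

Lemma cards2_sorted n (w : {set 'I_n}) : #|w| = 2%N ->
  exists i j : 'I_n, (i < j)%N /\ w = [set i; j]%SET.
Proof.
rewrite cardE; case e : (enum w) => [|i [|j []]] // _; exists i, j.
have := sorted_enum e => /= /andP[ij _]; split=> //; apply/setP => u.
by rewrite -mem_enum e !inE.
Qed.

Lemma cards3_sorted n (w : {set 'I_n}) : #|w| = 3%N ->
  exists i j k : 'I_n, [/\ (i < j)%N, (j < k)%N & w = [set i; j; k]%SET].
Proof.
rewrite cardE; case e : (enum w) => [|i [|j [|k []]]] // _; exists i, j, k.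
have := sorted_enum e => /= /and3P[ij jk _]; split=> //; apply/setP => u.
by rewrite -mem_enum e !inE orbA.
Qed.

(** * The full family and its intersections *)

Section Members.
Context {R : realType} (q : nat).
Hypothesis q1 : (0 < q)%N.

Notation Q := q%:Z.
Notation J := (option (option 'I_(3 * q).+1)).

Let Q1 : 1 <= Q. Proof. by move: q1; clear; lia. Qed.

Definition line_index (i : 'I_(3 * q).+1) : int := i%:Z + 1 - Q.

Let il (i : 'I_(3 * q).+1) : idx Q (line_index i).
Proof. by have := ltn_ord i; rewrite /idx /line_index; clear; lia. Qed.

Let ne (i j : 'I_(3 * q).+1) : i != j -> line_index i != line_index j.
Proof. by rewrite -val_eqE /line_index /=; clear; lia. Qed.

Let lt (i j : 'I_(3 * q).+1) : (i < j)%N -> line_index i < line_index j.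
Proof. by rewrite /line_index; clear; lia. Qed.

Definition chord (i : 'I_(3 * q).+1) : set (R * R) := Line Q (line_index i) (1/5).

Definition member (o : J) : set (R * R) :=
  match o with None => Net Q | Some None => Comb Q | Some (Some i) => chord i end.

Lemma member_open o : open (member o).
Proof.
by case: o => [[i|]|]; [exact: Line_open|exact: Comb_open|exact: Net_open].
Qed.

Lemma inter0 : inter chord finset.set0 = setT.
Proof. by apply/seteqP; split=> // p _ i; rewrite /= inE. Qed.

Lemma inter1 i : inter chord [set i]%SET = chord i.
Proof.
apply/seteqP; split=> p h; first by apply: h; rewrite /= inE.
by move=> j; rewrite /= inE => /eqP ->.
Qed.

Lemma inter2 i j : inter chord [set i; j]%SET = chord i `&` chord j.
Proof.
apply/seteqP; split=> p h; first by split; apply: h; rewrite /= !inE eqxx ?orbT.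
by move=> k; rewrite /= !inE => /orP[] /eqP ->; case: h.
Qed.

Lemma inter3 i j k : inter chord [set i; j; k]%SET = chord i `&` chord j `&` chord k.
Proof.
apply/seteqP; split=> p h.
  by split; first split; apply: h; rewrite /= !inE eqxx ?orbT.
by move=> l; rewrite /= !inE => /orP[/orP[]|] /eqP ->; case: h => -[].
Qed.

(** Pigeonhole on the three directions: distinct lines through one point use arms of distinct
    directions. *)
Lemma chord4 (w : {set 'I_(3 * q).+1}) : (3 < #|w|)%N -> inter chord w = set0.
Proof.
move=> w4; apply/seteqP; split=> // p pw; move: w4; rewrite ltnNge => /negP; apply.
pose dir (i : 'I_(3 * q).+1) (e : 'I_3) :=
  `[< exists2 z, isarm Q (line_index i) z /\ z.1 = e & @Arm R Q z (1/5) p >].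
pose f i : 'I_3 := odflt ord0 [pick e | dir i e].
have fP i : i \in w -> dir i (f i).
  rewrite /f; case: pickP => //= h /pw[z zl zp].
  have e3 : (z.1 < 3)%N by exact: isarm_dir zl.
  by have /asboolP[] := negbT (h (Ordinal e3)); exists z.
apply: (@leq_trans #|'I_3|); last by rewrite card_ord.
apply: (@leq_card_in _ _ f) => i j /fP/asboolP[z [zi ze] zp] /fP/asboolP[z' [zj ze'] zp'] e.
apply/eqP; apply: contraT => /ne n.
have := pair_dir Q1 (il i) (il j) n zi zj zp zp'.
by rewrite ze ze' e eqxx.
Qed.

Lemma chord3_thin (i j k : 'I_(3 * q).+1) p : (i < j)%N -> (j < k)%N ->
  chord i p -> chord j p -> chord k p -> ~ Net Q p.
Proof.
move=> ij jk pi pj pk.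
have nij : line_index i != line_index j by rewrite lt_eqF ?lt.
have njk : line_index j != line_index k by rewrite lt_eqF ?lt.
have nik : line_index i != line_index k by rewrite lt_eqF ?lt // (ltn_trans ij).
case=> [pr|[l hl lp]]; first exact: (pair_rim Q1 (il i) (il j) nij pi pj pr).
have [e|nli] := eqVneq l (line_index i).
  by subst l; exact: (triple_thin Q1 (il i) (il j) (il k) nij nik njk lp pj pk).
have [e|nlj] := eqVneq l (line_index j).
  subst l; apply: (triple_thin Q1 (il j) (il i) (il k) _ njk nik lp pi pk).
  by rewrite eq_sym.
exact: (triple_thin Q1 hl (il i) (il j) nli nlj nij lp pi pj).
Qed.

Lemma star_setT : star [set: R * R] 0.
Proof. by []. Qed.

Lemma star_empty_contractible (S : set (R * R)) :
  (forall p, S p -> star S p) -> S = set0 \/ contractible R S.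
Proof.
move=> h; have [->|/set0P[p /h sp]] := eqVneq S set0; first by left.
by right; exact: star_contractible sp.
Qed.

Lemma triple_chord_star (i j k : 'I_(3 * q).+1) p : (i < j)%N -> (j < k)%N ->
  (chord i `&` chord j `&` chord k) p -> star (chord i `&` chord j `&` chord k) p.
Proof.
by move=> ij jk; apply: (triple_star Q1 (il i) (il j) (il k)); rewrite lt_eqF ?lt // (ltn_trans ij).
Qed.

Lemma member_inter (s : {set J}) :
  inter member s = (if None \in s then Net Q else setT) `&`
    ((if Some None \in s then Comb Q else setT) `&` inter chord (somes (somes s))).
Proof. by rewrite !inter_option inE. Qed.

Lemma card_member (s : {set J}) :
  #|s| = ((None \in s) + ((Some None \in s) + #|somes (somes s)|))%N.
Proof. by rewrite !card_somes inE. Qed.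

Lemma member4 (s : {set J}) : (3 < #|s|)%N -> inter member s = set0.
Proof.
rewrite card_member member_inter; set w := somes _ => s4.
have [w4|w3] := ltnP 3 #|w|; first by rewrite chord4 // !setI0.
apply/seteqP; split=> // p [pn [px pw]].
move: s4; have [w2|w2] := leqP #|w| 2.
  case: ifP pn => [_|]; last by move: w2; clear; case: (_ \in _) => /=; lia.
  case: ifP px => [_|]; last by move: w2; clear; lia.
  move=> px pn w2'; have : #|w| = 2%N by move: w2 w2'; clear; lia.
  case/cards2_sorted => i [j [ij e]]; move: pw; rewrite e inter2 => -[pi pj].
  apply: (pair_rim Q1 (il i) (il j) _ pi pj); first by rewrite lt_eqF ?lt.
  by rewrite -(comb_net Q1).
have : #|w| = 3%N by move: w2 w3; clear; lia.
case/cards3_sorted => i [j [k [ij jk e]]]; move: pw; rewrite e inter3 => -[[pi pj] pk].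
case: ifP pn => [_ pn _|_ _]; first exact: (chord3_thin ij jk pi pj pk pn).
case: ifP px => [_ px _|_ _]; last by rewrite -e; move: w3; clear; lia.
exact: (triple_comb Q1 (il i) (il j) (il k) (lt ij) (lt jk) pi pj pk px).
Qed.

(** Triples without the net are left out because they may be empty. That those with the net are
    nonempty is what later yields the full binomial coefficient. *)
Lemma member_contractible (s : {set J}) : s != [set None]%SET -> (#|s| <= 3)%N ->
  (None \in s) || (#|s| <= 2)%N -> contractible R (inter member s).
Proof.
rewrite card_member member_inter => sN s3 s2.
have w1 : 0 < (1/5 : R) <= 1/5 by lra.
have we : 0 <= (1/50 : R) <= 4/25 by lra.
have w5 : (1/50 : R) < 1/5 by lra.
case e : #|somes (somes s)| s3 s2 => [|[|[|[|u]]]].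
- move/eqP: e; rewrite cards_eq0 => /eqP e _ _; rewrite e inter0 setIT.
  case: ifP => [ns|_]; case: ifP => xs; rewrite ?setTI ?setIT.
  + rewrite setIC comb_net //; exact: rim_contractible.
  + case/eqP: sN; apply/setP => -[[i|]|]; rewrite !inE ?ns ?xs //.
    by have := congr1 (fun w : {set _} => i \in w) e; rewrite !inE => ->.
  + exact: comb_contractible.
  + exact: star_contractible star_setT.
- move/eqP/cards1P: e => [i e] _ _; rewrite e inter1.
  case: ifP => _; case: ifP => _; rewrite ?setTI.
  + rewrite setIC [Comb Q `&` _]setIC; exact: star_contractible (line_comb_net_star Q1 (il i)).
  + rewrite setIC; exact: line_net_contractible.
  + rewrite setIC; exact: line_comb_contractible.
  + exact: star_contractible (Line_star Q1 (il i) we w5).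
- case/cards2_sorted: e => i [j [ij e]]; rewrite e inter2.
  have n : line_index i != line_index j by rewrite lt_eqF ?lt.
  case: ifP => _; case: ifP => _ //= _ _; rewrite ?setTI.
  + rewrite setIC; exact: star_contractible (pair_net_star Q1 (il i) (il j) n).
  + exact: star_contractible (pair_star Q1 (il i) (il j) n w1 w1).
- by case: (None \in s) => //=; case: (Some None \in s).
- by case: (None \in s) => //=; case: (Some None \in s).
Qed.

Lemma member3 (s : {set J}) : #|s| = 3%N ->
  inter member s = set0 \/ contractible R (inter member s).
Proof.
move=> s3; have [ns|ns] := boolP (None \in s).
  right; apply: member_contractible; rewrite ?s3 ?ns //.
  by apply: contra_eq_neq s3 => ->; rewrite cards1.
move: s3; rewrite card_member member_inter (negPf ns) add0n setTI.
case: ifP => _ /=.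
  move=> [/cards2_sorted [i [j [ij ->]]]]; rewrite inter2 setIC.
  by apply: star_empty_contractible => p; apply: (pair_comb_star Q1 (il i) (il j) (lt ij)).
rewrite add0n setTI => /cards3_sorted [i [j [k [ij jk ->]]]]; rewrite inter3.
by apply: star_empty_contractible => p; exact: triple_chord_star.
Qed.

Lemma member_path_connected (s : {set J}) :
  inter member s = set0 \/ path_connected R (inter member s).
Proof.
have [->|sN] := eqVneq s [set None]%SET.
  right; rewrite member_inter !inE /= (_ : somes _ = finset.set0) ?inter0 ?setIT.
    exact: net_path_connected.
  by apply/setP => i; rewrite !inE.
case: (ltngtP #|s| 3) => [s2|s4|/member3[|]]; [right|left|left|right] => //.
- apply: contractible_path_connected; apply: member_contractible => //; first exact: ltnW.
  by rewrite ltnS in s2; rewrite s2 orbT.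
- exact: member4.
- exact: contractible_path_connected.
Qed.

Lemma member_subfamily (D : {set J}) : None \in D ->
  let A := family member (D := D) in
  [/\ forall i, open (A i),
     forall s, meet A s = set0 \/ path_connected R (meet A s),
     fnum A 3 = 0%N & contractible_but_one R A].
Proof.
move=> ND A; split.
- by move=> i; exact: member_open.
- by move=> s; rewrite meet_family; exact: member_path_connected.
- rewrite fnum_family; apply/eqP; rewrite cards_eq0; apply/eqP/setP => s; rewrite !inE.
  apply/negP => /and3P[_ /eqP s4 /asboolP[p]]; rewrite setTI member4 //.
  by rewrite s4.
- split.
  + exists (enum_rank_in ND None) => i; split=> [ci ei|ni].
      by apply: (@net_not_contractible R Q Q1); move: ci; rewrite /A /family ei enum_rankK_in.
    have -> : A i = inter member [set enum_val i]%SET.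
      apply/seteqP; split=> [p pi j|p h]; first by rewrite /= inE => /eqP ->.
      by apply: h; rewrite /= inE.
    apply: member_contractible; rewrite ?cards1 ?orbT //.
    apply: contra_not_neq ni => /set1_inj h.
    by apply: enum_val_inj; rewrite enum_rankK_in.
  + move=> s s2; rewrite meet_family; apply: member_contractible; rewrite ?card_family ?s2 ?orbT //.
    by apply/eqP => h; have := card_family s; rewrite h cards1 s2.
  + by move=> s s3; rewrite meet_family; apply: member3; rewrite card_family.
Qed.

End Members.

(** * Nonempty triples of the family *)

Section Counting.
Context {R : realType} (q : nat).
Hypothesis q1 : (0 < q)%N.

Notation Q := q%:Z.
Notation J := (option (option 'I_(3 * q).+1)).
Notation chord := (@chord R q).
Notation member := (@member R q).

Let Q1 : 1 <= Q. Proof. by move: q1; clear; lia. Qed.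

Let il (i : 'I_(3 * q).+1) : idx Q (line_index i).
Proof. by have := ltn_ord i; rewrite /idx /line_index; clear; lia. Qed.

Let lt (i j : 'I_(3 * q).+1) : (i < j)%N -> line_index i < line_index j.
Proof. by rewrite /line_index; clear; lia. Qed.

Let predE (k : 'I_(3 * q).+1) : ord_pred k = (if k == 0%N :> nat then 3 * q else k.-1)%N :> nat.
Proof.
rewrite /= addnS /=; have := ltn_ord k; case: (nat_of_ord k) => [|u] hu /=.
  by rewrite add0n modn_small.
by rewrite addSnnS modnDr modn_small // ltnW.
Qed.

Let valE (i j : 'I_(3 * q).+1) : (i == j) = (nat_of_ord i == nat_of_ord j).
Proof. by []. Qed.

(* The lines k - 1 and k modulo 3 q + 1 bound the face of the tooth k - q, which
   is missing for k = q. *)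
Lemma comb_pairs : #|nerve (Comb Q) chord 2 [set: 'I_(3 * q).+1]%SET| = (3 * q)%N.
Proof.
have qm : (q < (3 * q).+1)%N by move: q1; clear; lia.
pose f (k : 'I_(3 * q).+1) := [set ord_pred k; k]%SET.
have inj : injective f.
  move=> k k' e; apply/val_inj => /=.
  have : k \in f k' by rewrite -e !inE eqxx orbT.
  have : k' \in f k by rewrite e !inE eqxx orbT.
  rewrite !inE !valE !predE; move: q1; clear.
  by repeat case: ifP; lia.
transitivity #|[set~ Ordinal qm]%SET|; last by rewrite cardsC1 card_ord.
rewrite -(card_imset _ inj); apply: eq_card => s; rewrite inE.
apply/and3P/imsetP => [[_ /eqP/cards2_sorted [i [j [ij ->]]] /asboolP[p []]]|[k]].
  rewrite inter2 => xp ijp.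
  have [t [it elo ehi _]] := pair_comb Q1 (il i) (il j) (lt ij) (conj ijp xp).
  (* In cyclic order the later line is [j], except for [t = - Q], where [i] is the first line and
     [j] the last, its cyclic predecessor. *)
  exists (if t == - Q then i else j).
    rewrite !inE valE /=; move: elo ehi it q1; rewrite /lo /hi /line_index /tidx; clear.
    by repeat case: ifP; lia.
  apply/setP => u; rewrite !inE !valE predE.
  move: elo ehi it q1 ij; rewrite /lo /hi /line_index /tidx; clear.
  by have := ltn_ord j; repeat case: ifP; lia.
rewrite !inE valE /= => kq ->; rewrite finset.subsetT cards2.
have it : tidx Q (k%:Z - Q) by have := ltn_ord k; move: kq; rewrite /tidx; clear; lia.
have [p [z [z' [zl zl' zp zp' tp]]]] := @tooth_vertex R Q Q1 _ it.
split=> //; first by rewrite valE predE; move: q1; clear; repeat case: ifP; lia.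
exists p; rewrite inter2; split; first by right; exists (k%:Z - Q).
have [k0|k0] := eqVneq (k : nat) 0%N.
  split; [exists z'|exists z] => //.
    have <- : hi Q (k%:Z - Q) = line_index (ord_pred k) => //.
    by rewrite /hi /line_index predE k0 sub0r !eqxx; clear; lia.
  have <- : lo Q (k%:Z - Q) = line_index k => //.
  by rewrite /lo /line_index k0 sub0r eqxx; clear; lia.
split; [exists z|exists z'] => //.
  have <- : lo Q (k%:Z - Q) = line_index (ord_pred k) => //.
  by rewrite /lo /line_index predE; move: k0; clear; repeat case: ifP; lia.
have <- : hi Q (k%:Z - Q) = line_index k => //.
by rewrite /hi /line_index; move: k0; clear; repeat case: ifP; lia.
Qed.

(** Since [line_index i] is [i + 1 - q], the sums 1 and 2 of three indices become [3 * q - 2] and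
    [3 * q - 1] for the ordinals. *)
Let c1 : 'I_(3 * q).+1 := inord (3 * q - 2).
Let c2 : 'I_(3 * q).+1 := inord (3 * q - 1).

Let modn3 a m c : (a < 3 * m)%N -> (c < m)%N ->
  (a %% m == c)%N = [|| a == c, a == c + m | a == c + m + m]%N.
Proof.
move=> am cm; have m0 : (0 < m)%N by case: m cm {am}.
have := ltn_pmod a m0; have : (a %/ m < 3)%N by rewrite ltn_divLR.
have := divn_eq a m; move: (a %% m)%N (a %/ m)%N cm; clear.
by move=> r [|[|[|d]]] //; lia.
Qed.

Let sumE (i j k c : 'I_(3 * q).+1) : (i + j + k == c) = ((i + j + k) %% (3 * q).+1 == c)%N.
Proof. by rewrite -val_eqE /= modnDml. Qed.

Lemma chord_triples (W : {set 'I_(3 * q).+1}) :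
  nerve setT chord 3 W = [set s in sum3 c1 :|: sum3 c2 | s \subset W]%SET.
Proof.
apply/setP => s; rewrite !inE andbC [RHS]andbC; case: (s \subset W); rewrite ?andbF // andbT /=.
case: eqP => //= s3; have [i [j [k [ij jk ->]]]] := cards3_sorted s3.
rewrite !sum_set3; try by rewrite valE ltn_eqF // (ltn_trans ij).
rewrite !sumE.
have hk := ltn_ord k.
rewrite !modn3 ?inordK; try (by move: ij jk hk q1; clear; lia).
apply/asboolP/idP => [[p []]|h].
  rewrite inter3 => _ [[[z zl zp] [z' zl' zp']] [z'' zl'' zp'']].
  have n (u v : 'I_(3 * q).+1) : (u < v)%N -> line_index u != line_index v.
    by move=> uv; rewrite lt_eqF // lt.
  have [a [b [c [ha hb hc]]]] := three_arms Q1 (il i) (il j) (il k) (n _ _ ij)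
    (n _ _ (ltn_trans ij jk)) (n _ _ jk) zl zl' zl'' zp zp' zp''.
  by have := Arm_sum Q1 ha hb hc; rewrite /line_index; move: q1; clear; lia.
have [] := @triple_vertex R Q Q1 _ _ _ (il i) (il j) (il k) (lt ij) (lt jk).
  by move: h ij jk hk q1; rewrite /line_index; clear; lia.
move=> p [z [z' [z'' [zl zl' zl'' zp [zp' zp'']]]]].
by exists p; split=> //; rewrite inter3; split; first split; [exists z|exists z'|exists z''].
Qed.

Let sum3_disjoint : sum3 c1 :&: sum3 c2 = finset.set0.
Proof.
apply/setP => s; rewrite !inE; apply/negP => /andP[/andP[_ /eqP ->]] /andP[_].
by rewrite valE !inordK; move: q1; clear; lia.
Qed.

(* 2 q + 1 is the inverse of 3 modulo 3 q + 1. *)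
Let thirds (c x : 'I_(3 * q).+1) : (x *+ 3 == c) = (x == c *+ (q.*2).+1).
Proof.
have K (y : 'I_(3 * q).+1) : y *+ 3 *+ (q.*2).+1 = y.
  have e : (3 * (q.*2).+1 = 2 * (3 * q).+1 + 1)%N by clear; lia.
  by apply: val_inj; rewrite -mulrnA Zp_mulrn e /= mulnDr muln1 mulnA modnMDl modn_small.
apply/eqP/eqP => [<-|->]; first by rewrite K.
by rewrite mulrnAC K.
Qed.

Lemma card_chord_triples : #|nerve setT chord 3 [set: 'I_(3 * q).+1]%SET| = (q * (3 * q - 1))%N.
Proof.
rewrite chord_triples (_ : [set _ in _ | _]%SET = sum3 c1 :|: sum3 c2); last first.
  by apply/setP => s; rewrite inE finset.subsetT andbT.
rewrite cardsU (_ : #|_ :&: _| = 0)%N; last by rewrite sum3_disjoint cards0.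
have h c : (#|sum3 (c : 'I_(3 * q).+1)| * 6 = 3 * q * (3 * q).-1)%N.
  rewrite card_sum3 ?card_ord //; exists (c *+ (q.*2).+1) => x; exact: thirds.
have := h c1; have := h c2; have : ((3 * q).-1 = 3 * q - 1)%N by move: q1; clear; lia.
move=> ->; move: (3 * q - 1)%N => u; move: #|sum3 c1| #|sum3 c2|; clear; nia.
Qed.

Lemma card_chord_triples_but i0 :
  (q * (3 * q - 1) <= #|nerve setT chord 3 [set~ (i0 : 'I_(3 * q).+1)]%SET| + 3 * q)%N.
Proof.
rewrite -card_chord_triples !chord_triples.
set S := sum3 c1 :|: sum3 c2.
have d c := @sum3_degree _ (c : 'I_(3 * q).+1) i0.
apply: (@leq_trans (#|[set s in S | s \subset [set~ i0]]%SET| +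
    #|[set s in sum3 c1 | i0 \in s]%SET :|: [set s in sum3 c2 | i0 \in s]%SET|)%N); last first.
  rewrite leq_add2l (leq_trans (leq_card_setU _ _)) //.
  by have := d c1; have := d c2; rewrite card_ord /=; clear; lia.
apply: leq_trans (leq_card_setU _ _); apply: subset_leq_card; apply/fintype.subsetP => s.
rewrite !inE => /andP[sS _]; rewrite sS /=.
have [i0s|i0s] := boolP (i0 \in s); last first.
  apply/orP; left; apply/fintype.subsetP => x xs; rewrite !inE.
  by apply: contraNneq i0s => <-.
by apply/orP; right; rewrite !andbT.
Qed.

Lemma fnum_member (D : {set J}) : None \in D -> fnum (family member (D := D)) 2 =
  ('C(#|D|.-1, 2) + #|nerve setT chord 3 (somes (somes D))| +
   (Some None \in D) * #|nerve (Comb Q) chord 2 (somes (somes D))|)%N.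
Proof.
move=> ND; rewrite fnum_family nerve_option ND mul1n nerve_option inE !setTI.
rewrite [LHS]addnC addnA nerve_all; first by rewrite (card_somes D) ND.
move=> s s2; pose s' := (None |: Some @: s)%SET.
have e : somes s' = s.
  by apply/setP => i; rewrite !inE /= (mem_imset _ _ Some_inj).
have ns : None \in s' by rewrite !inE.
have := @member_contractible R q q1 s'.
rewrite card_somes e s2 ns inter_option ns e => -[] //.
  by apply/eqP => s'E; have := card_somes s'; rewrite e s2 ns s'E cards1.
by move=> c [cs _]; exists c.
Qed.

End Counting.

(** * Families of each size, and the theorem *)

Section Bounds.
Context {R : realType} (q : nat).
Hypothesis q1 : (0 < q)%N.

Notation J := (option (option 'I_(3 * q).+1)).

Lemma full_family : exists B : 'I_(3 * q + 3) -> set (R * R)%type,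
  [/\ forall i, open (B i),
     forall s : {set 'I_(3 * q + 3)}, meet B s = set0 \/ path_connected R (meet B s),
     fnum B 3 = 0%N,
     fnum B 2 = ('C(3 * q + 2, 2) + q * (3 * q - 1) + 3 * q)%N
   & contractible_but_one R B].
Proof.
have -> : (3 * q + 3 = #|[set: J]%SET|)%N by rewrite cardsT !card_option card_ord addn3.
exists (family (@member R q) (D := [set: J]%SET)).
have ND : None \in [set: J]%SET by rewrite inE.
have [? ? ? ?] := @member_subfamily R q q1 _ ND; split=> //.
have e : somes (somes [set: J]%SET) = [set: 'I_(3 * q).+1]%SET by apply/setP => i; rewrite !inE.
rewrite fnum_member // e comb_pairs // card_chord_triples // inE mul1n.
by rewrite cardsT !card_option card_ord addn2.
Qed.

Lemma no_comb_family : exists B : 'I_(3 * q + 2) -> set (R * R)%type,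
  [/\ forall i, open (B i),
     forall s : {set 'I_(3 * q + 2)}, meet B s = set0 \/ path_connected R (meet B s),
     fnum B 3 = 0%N,
     fnum B 2 = ('C(3 * q + 1, 2) + q * (3 * q - 1))%N
   & contractible_but_one R B].
Proof.
pose D : {set J} := [set~ Some None]%SET.
have -> : (3 * q + 2 = #|D|)%N by rewrite cardsC1 !card_option card_ord addn2.
exists (family (@member R q) (D := D)).
have ND : None \in D by rewrite !inE.
have [? ? ? ?] := @member_subfamily R q q1 _ ND; split=> //.
have e : somes (somes D) = [set: 'I_(3 * q).+1]%SET by apply/setP => i; rewrite !inE.
rewrite fnum_member // e card_chord_triples // !inE eqxx addn0.
by rewrite cardsC1 !card_option card_ord addn1.
Qed.

Lemma no_comb_chord_family : exists B : 'I_(3 * q + 1) -> set (R * R)%type,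
  [/\ forall i, open (B i),
     forall s : {set 'I_(3 * q + 1)}, meet B s = set0 \/ path_connected R (meet B s),
     fnum B 3 = 0%N,
     ('C(3 * q, 2) + q * (3 * q - 1) <= fnum B 2 + 3 * q)%N
   & contractible_but_one R B].
Proof.
pose i0 : 'I_(3 * q).+1 := ord0.
pose D : {set J} := (~: [set Some None; Some (Some i0)])%SET.
have cD : (3 * q + 1 = #|D|)%N.
  rewrite cardsCs finset.setCK cards2 !card_option card_ord /=.
  by rewrite addn1 subSS subSS subn0.
have -> := cD.
exists (family (@member R q) (D := D)).
have ND : None \in D by rewrite !inE.
have [? ? ? ?] := @member_subfamily R q q1 _ ND; split=> //.
have e : somes (somes D) = [set~ i0]%SET by apply/setP => i; rewrite !inE.
rewrite fnum_member // e -cD !inE eqxx addn0 addn1 /= -addnA leq_add2l.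
exact: card_chord_triples_but.
Qed.

End Bounds.

Theorem theorem2p4 (R : realType) :
  (forall n : nat, (6 <= n)%N ->
     exists A : 'I_n -> set (R * R)%type,
       [/\ forall i : 'I_n, open (A i),
           forall s : {set 'I_n}, meet A s = set0 \/ path_connected R (meet A s),
           fnum A 3 = 0%N,
           ('C(n.-1, 2)%:R + (n%:R ^+ 2 - 6 * n%:R + 3) / 3 : rat)
             <= (fnum A 2)%:R
         & contractible_but_one R A]) /\
  infinite_set [set n : nat |
     exists B : 'I_n -> set (R * R)%type,
       [/\ forall i : 'I_n, open (B i),
           forall s : {set 'I_n}, meet B s = set0 \/ path_connected R (meet B s),
           fnum B 3 = 0%N,
           (fnum B 2)%:R =
             ('C(n.-1, 2)%:R + (n%:R ^+ 2 - 4 * n%:R + 3) / 3 : rat)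
         & contractible_but_one R B]].
Proof.
have real_of (q : nat) : (0 < q)%N -> (3 * q - 1)%:R = 3 * q%:R - 1 :> rat.
  by move=> q1; rewrite natrB ?natrM // muln_gt0.
split=> [n n6|].
  have [q [q1 h]] : exists q, (0 < q)%N /\ (n = 3 * q + 3 \/ n = 3 * q + 2 \/ n = 3 * q + 1)%N.
    (* Multiples of 3 use the full family, so [n = 6] corresponds to [q = 1]. *)
    exists ((n - 1) %/ 3)%N; move: n6; clear; lia.
  have q1' : 1 <= q%:R :> rat by rewrite ler1n.
  case: h => [->|[->|->]].
  - have [B [? ? ? f2 ?]] := @full_family R q q1; exists B; split=> //.
    rewrite f2 (_ : (3 * q + 3).-1 = 3 * q + 2)%N; last by clear; lia.
    by rewrite !(natrD, natrM) real_of //; move: q1'; clear; nra.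
  - have [B [? ? ? f2 ?]] := @no_comb_family R q q1; exists B; split=> //.
    rewrite f2 (_ : (3 * q + 2).-1 = 3 * q + 1)%N; last by clear; lia.
    by rewrite !(natrD, natrM) real_of //; move: q1'; clear; nra.
  (* This case is nearly sharp: [q * (3 * q - 1) - 3 * q] exceeds the required
     [(n ^ 2 - 6 * n + 3) / 3] by just [2/3]. *)
  - have [B [? ? ? f2 ?]] := @no_comb_chord_family R q q1; exists B; split=> //.
    move: f2; rewrite -(ler_nat rat) (_ : (3 * q + 1).-1 = 3 * q)%N; last by clear; lia.
    by rewrite !(natrD, natrM) real_of //; clear; lra.
pose f q := (3 * q.+1 + 3)%N.
set S := [set n : nat | _] => fin; apply: infinite_nat.
suff <- : f @^-1` S = [set: nat].
  by apply: finite_preimage fin => i j _ _; rewrite /f; clear; lia.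
apply/seteqP; split=> // q _ /=; rewrite /f /S.
have [B [? ? ? f2 ?]] := @full_family R q.+1 isT; exists B; split=> //.
rewrite f2 (_ : (3 * q.+1 + 3).-1 = 3 * q.+1 + 2)%N; last by clear; lia.
by rewrite !(natrD, natrM) real_of //; field.
Qed.
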